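(* (Universality of exponential convergence via analyticity in the quasiperiodic case.) There exists an absolute constant $\beta_*>0$ with the following property. Let $d\in\mathbb N^+$, let $\tau>d-1$, $\alpha>0$, let $\rho\in\mathbb T^d$ satisfy the finite-dimensional Diophantine condition with parameters $\alpha,\tau$ (in the discrete sense (a) for the first estimate, in the continuous sense (b) for the second estimate), and let $f:\mathbb T^d\to\mathcal B$ be analytic in some neighbourhood of $\mathbb T^d$ in $\mathbb C^d$. Put $$\xi=\beta_*(1+\tau\beta_* )^{-1}>0 .$$ Then there exist $\tilde c>0$ and a constant $C_5>0$, independent of $N$ and $T$, such that for all sufficiently large $N$ (integer) and $T$ (real) and all $\theta\in\mathbb T^d$: (discrete case) if $\rho$ satisfies (a), then $$\left\|\overline{\mathrm{WB}}_N(f)(\theta)-\int_{\mathbb T^d}f(\hat\theta)\,d\hat\theta\right\|_{\mathcal B}\le C_5\exp\left(-\tilde c N^{\xi}\right);$$ (continuous case) if $\rho$ satisfies (b), then $$\left\|\frac1T\int_0^T\bar w(t/T)\,f(\rho t+\theta)\,dt-\int_{\mathbb T^d}f(\hat\theta)\,d\hat\theta\right\|_{\mathcal B}\le C_5\exp\left(-\tilde c T^{\xi}\right).$$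
   Context: $\mathbb T^d=\mathbb R^d/\mathbb Z^d$ with normalized Lebesgue measure; $\rho\in\mathbb T^d$ is identified with a fixed representative in $\mathbb R^d$. For $k\in\mathbb Z^d$, $\|k\|=|k_1|+\cdots+|k_d|$. The finite-dimensional Diophantine condition with parameters $\alpha>0$, $\tau>d-1$ is (a) (discrete case) $|k\cdot\rho-n|\ge\alpha/\|k\|^\tau$ for all $0\ne k\in\mathbb Z^d$ and all $n\in\mathbb Z$; (b) (continuous case) $|k\cdot\rho|\ge\alpha/\|k\|^\tau$ for all $0\ne k\in\mathbb Z^d$. $(\mathcal B,\|\cdot\|_{\mathcal B})$ is a Banach (function) space, possibly infinite-dimensional, over complex scalars. The weighting function is $$\bar w(x)=\left(\int_0^1\exp\left(-s^{-1}(1-s)^{-1}\right)ds\right)^{-1}\exp\left(-x^{-1}(1-x)^{-1}\right)\ \text{ on }(0,1),\qquad \bar w(0)=\bar w(1)=0.$$ With $T_\rho(\theta)=\theta+\rho \bmod 1$ in each coordinate, $$\overline{\mathrm{WB}}_N(f)(\theta)=\frac1{A_N}\sum_{n=0}^{N-1}\bar w\!\left(\frac nN\right)f(T_\rho^n(\theta)),\qquad A_N=\sum_{n=0}^{N-1}\bar w\!\left(\frac nN\right).$$ *)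

(* Defs.v *)
From HB Require Import structures.
From mathcomp Require Export all_boot all_order all_algebra.
From mathcomp Require Export complex.
From mathcomp Require Export all_classical all_reals all_analysis.
From mathcomp Require Export summability.

Set Implicit Arguments.
Unset Strict Implicit.
Unset Printing Implicit Defensive.

Import Order.TTheory GRing.Theory Num.Theory.
Import numFieldNormedType.Exports.

Local Open Scope classical_set_scope.
Local Open Scope ring_scope.
Local Open Scope complex_scope.

(** * Lebesgue measure on the torus *)

(* T^d is represented by Z^d-periodic objects on R^d = 'rV[R]_d, and its
   normalized Lebesgue measure by the d-fold product of the uniform probability
   on the fundamental domain [0, 1]^d.  Tuples carry the product
   sigma-algebra. *)
Section torus_measure.
Context {R : realType}.

Definition tuple_cons n (p : measurableTypeR R * n.-tuple (measurableTypeR R)) :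
    n.+1.-tuple (measurableTypeR R) :=
  [tuple of p.1 :: p.2].

Lemma measurable_tuple_cons n : measurable_fun [set: _] (@tuple_cons n).
Proof. exact: measurable_cons. Qed.

HB.instance Definition _ n := isMeasurableFun.Build _ _ _ _
  (@tuple_cons n) (@measurable_tuple_cons n).

Fixpoint torus_measure (d : nat) : probability (d.-tuple (measurableTypeR R)) R :=
  match d with
  | 0 => \d_([tuple])
  | n.+1 => distribution
      (uniform_prob (@ltr01 R) \x torus_measure n)%E (@tuple_cons n)
  end.

End torus_measure.

(** * The Bochner integral *)

Section bochner.
Context {R : realType} {B : completeNormedModType R[i]}.

(* The norm of a complex normed module is [R[i]]-valued (with values in the
   nonnegative reals). *)
Definition bnorm (v : B) : R := complex.Re `|v|.

Context d (T : measurableType d) (mu : {measure set T -> \bar R}) (D : set T).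

Definition integrable_simple (s : T -> B) : Prop :=
  [/\ finite_set (range s),
      forall b, measurable (s @^-1` [set b])
    & forall b, b != 0 -> (mu (D `&` s @^-1` [set b]) < +oo)%E].

Definition simple_integral (s : T -> B) : B :=
  \sum_(b \in range s) (fine (mu (D `&` s @^-1` [set b])))%:C *: b.

Definition is_bochner_integral (f : T -> B) (v : B) : Prop :=
  exists s : nat -> T -> B,
    [/\ forall n, integrable_simple (s n),
        forall n, mu.-integrable D (fun x => (bnorm (f x - s n x))%:E),
        (fun n => \int[mu]_(x in D) (bnorm (f x - s n x))%:E)%E @ \oo
          --> 0%E
      & (fun n => simple_integral (s n)) @ \oo --> v].

(* Equal to 0 when [f] is not Bochner integrable. *)
Definition bochner_integral (f : T -> B) : B :=
  xget 0 [set v | is_bochner_integral f v].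

End bochner.

(** * Functions on the torus *)

Section torus.
Context {R : realType} {d : nat}.

(* The ascription selects the usual topology on C^d. *)
Local Notation Rd := 'rV[R]_d.
Local Notation Cd := 'rV[(R[i] : numFieldType)]_d.

Definition lattice {V : pzRingType} (m : 'rV[int]_d) : 'rV[V]_d :=
  map_mx intr m.

Definition real_point (theta : Rd) : Cd := map_mx (real_complex R) theta.

Definition point_of_tuple (x : d.-tuple R) : Rd := \row_j tnth x j.

Definition rotation (rho theta : Rd) : Rd :=
  \row_j ((theta 0 j + rho 0 j) - (Num.floor (theta 0 j + rho 0 j))%:~R).

Context {B : completeNormedModType R[i]}.

Definition torus_periodic (f : Rd -> B) : Prop :=
  forall theta m, f (theta + lattice m) = f theta.

Definition torus_integral (f : Rd -> B) : B :=
  bochner_integral (torus_measure d) setT (fun x => f (point_of_tuple x)).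

(* Near [a], [F] is the sum of a power series in [d] variables with
   coefficients in [B]; the sum over multi-indices is unconditional. *)
Definition analytic_at (F : Cd -> B) (a : Cd) : Prop :=
  exists c : {ffun 'I_d -> nat} -> B,
    nbhs a [set z : Cd |
      partial_sum (fun k : {ffun 'I_d -> nat} =>
        (\prod_(j < d) (z 0 j - a 0 j) ^+ k j) *: c k) @ totally --> F z].

(* A neighbourhood of T^d in C^d / Z^d is a Z^d-invariant neighbourhood [U] of
   R^d in C^d. *)
Definition torus_analytic (f : Rd -> B) : Prop :=
  exists (U : set Cd) (F : Cd -> B),
    [/\ open U,
        (forall theta, U (real_point theta)),
        (forall z m, U z -> U (z + lattice m) /\ F (z + lattice m) = F z),
        (forall z, U z -> analytic_at F z)
      & forall theta, F (real_point theta) = f theta].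

(** * Diophantine conditions *)

Definition norm1 (k : 'rV[int]_d) : R := \sum_(j < d) `|k 0 j|%:~R.

Definition dot (k : 'rV[int]_d) (rho : Rd) : R :=
  \sum_(j < d) (k 0 j)%:~R * rho 0 j.

Definition diophantine_discrete (alpha tau : R) (rho : Rd) : Prop :=
  forall k : 'rV[int]_d, k != 0 -> forall n : int,
    `|dot k rho - n%:~R| >= alpha / norm1 k `^ tau.

Definition diophantine_continuous (alpha tau : R) (rho : Rd) : Prop :=
  forall k : 'rV[int]_d, k != 0 -> `|dot k rho| >= alpha / norm1 k `^ tau.

End torus.

(** * Weighted Birkhoff averages *)

Section averages.
Context {R : realType}.

Definition bump (x : R) : R := expR (- (x^-1 * (1 - x)^-1)).

Definition weight (x : R) : R :=
  if 0 < x < 1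
  then (\int[lebesgue_measure]_(s in `[0, 1]) bump s)^-1 * bump x
  else 0.

Context {d : nat} {B : completeNormedModType R[i]}.

Definition weighted_birkhoff_discrete (N : nat) (rho : 'rV[R]_d)
    (f : 'rV[R]_d -> B) (theta : 'rV[R]_d) : B :=
  ((\sum_(0 <= n < N) weight (n%:R / N%:R))^-1)%:C *:
    \sum_(0 <= n < N)
      (weight (n%:R / N%:R))%:C *: f (iter n (rotation rho) theta).

Definition weighted_birkhoff_continuous (T : R) (rho : 'rV[R]_d)
    (f : 'rV[R]_d -> B) (theta : 'rV[R]_d) : B :=
  (T^-1)%:C *:
    bochner_integral lebesgue_measure `[0, T]
      (fun t => (weight (t / T))%:C *: f (t *: rho + theta)).

End averages.

(* Main.v *)
Require Import Defs.
From mathcomp Require Import finmap zify ring lra measurable_realfun.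

Set Implicit Arguments.
Unset Strict Implicit.
Unset Printing Implicit Defensive.

Import Order.TTheory GRing.Theory Num.Theory.
Import numFieldNormedType.Exports Normc.

Local Open Scope classical_set_scope.
Local Open Scope ring_scope.
Local Open Scope complex_scope.

(** The function [f] is approximated, with exponentially small error in the
    degree [K], by trigonometric polynomials
    [\sum_k expi (k . theta) *: b_k] over [|k_j| <= K], whose coefficients have
    a total norm polynomial in [K].  On a constant term the weighted average is
    exact.  On the term of frequency [k != 0] it is the weighted exponential sum
    [1 / N \sum_n w (n / N) expi (n x)] with [x = k . rho]; [m] summations by
    parts bound it by the [m]-th differences of [w] divided by
    [(N dist (x, Z)) ^ m], that is, by [(C m ^ 4 / (N dist (x, Z))) ^ m] because
    the derivatives of the weight grow like [m ^ (4 m)].  The optimal [m] yields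
    [exp (- c (N dist (x, Z)) ^ (1 / 4))] ([weighted_sum_le]).  The Diophantine
    condition gives [dist (x, Z) >= const K ^ (- tau)], so the total error is
    about [exp (- c K) + exp (- c (N K ^ (- tau)) ^ (1 / 4))], and [K = N ^ xi]
    balances the two terms when [xi = (1 / 4) / (1 + tau / 4)]; hence
    [beta = 1 / 4].

    Regularity is expressed throughout by finite differences, which make sense
    for functions with values in [B] without any differentiation: analyticity
    becomes [|Delta_h^m f| <= A ^ (m + 1) h ^ m m!] for differences in the
    direction of a coordinate ([torus_analytic_diff]).  It follows from the local
    power series, on each monomial by the mean value theorem, and uniformly by
    compactness of the torus ([torus_analytic_uniform]).  The same summation by
    parts then shows that discrete Fourier coefficients decay exponentially;
    this gives the trigonometric approximation in one variable
    ([trig_approx1]), and in several variables by treating one coordinate after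
    the other ([trig_approx]).  No Fourier integral occurs.

    Integrals occur only as limits of Riemann sums: a function uniformly
    approximated by step functions is Bochner integrable and its integral is the
    limit of the sums ([cvg_riemann_bochner]).  Applied to the torus, this
    compares [torus_integral f] with the constant term of the trigonometric
    polynomial, whose averages over fine grids are exact
    ([torus_integral_trig_approx]).  Applied to [[0, T]], it presents the
    continuous average as the limit, as [n] grows, of discrete averages with [n]
    terms for the translation by [(T / n) rho]; since
    [n dist (T / n k . rho, Z) = T |k . rho|] for large [n], the continuous case
    follows from the same estimate ([orbit_mean_approx]) as the discrete one. *)

(** * The norm of a complex Banach space *)

Lemma eqW {R : numDomainType} (x y : R) : x = y -> x <= y.
Proof. by move=> ->. Qed.

Lemma sumr_nat_cst {R : pzRingType} M (D : R) : \sum_(0 <= i < M) D = M%:R * D.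
Proof. by rewrite sumr_const_nat subn0 mulr_natl. Qed.

Section bnorm.
Context {R : realType} {B : completeNormedModType R[i]}.
Implicit Types (u v : B) (a : R[i]).

Lemma norm_bnorm v : `|v| = (bnorm v)%:C.
Proof. by rewrite /bnorm RRe_real ?ger0_real. Qed.

Lemma bnorm_ge0 v : 0 <= bnorm v.
Proof. by rewrite -ler0c -norm_bnorm. Qed.

Lemma bnorm0 : bnorm (0 : B) = 0.
Proof. by rewrite /bnorm normr0. Qed.

Lemma bnorm0_eq0 v : bnorm v = 0 -> v = 0.
Proof. by move=> v0; apply/eqP; rewrite -normr_eq0 norm_bnorm v0. Qed.

Lemma bnormN v : bnorm (- v) = bnorm v.
Proof. by rewrite /bnorm normrN. Qed.

Lemma bnormBC u v : bnorm (u - v) = bnorm (v - u).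
Proof. by rewrite -bnormN opprB. Qed.

Lemma ler_bnormD u v : bnorm (u + v) <= bnorm u + bnorm v.
Proof. by rewrite -lecR rmorphD/= -!norm_bnorm ler_normD. Qed.

Lemma ler_bnormB u v : bnorm (u - v) <= bnorm u + bnorm v.
Proof. by rewrite (le_trans (ler_bnormD _ _))// bnormN. Qed.

Lemma ler_bnorm_dist w u v : bnorm (u - v) <= bnorm (u - w) + bnorm (w - v).
Proof. by rewrite (le_trans _ (ler_bnormD _ _))// addrA subrK. Qed.

Lemma ler_bnorm_sum I (r : seq I) (P : pred I) (F : I -> B) :
  bnorm (\sum_(i <- r | P i) F i) <= \sum_(i <- r | P i) bnorm (F i).
Proof.
elim/big_rec2 : _ => [|i y x _ yx]; first by rewrite bnorm0.
by rewrite (le_trans (ler_bnormD _ _))// lerD2l.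
Qed.

Lemma bnormZ a v : bnorm (a *: v) = normc a * bnorm v.
Proof. by apply: complexI; rewrite rmorphM/= -!norm_bnorm normrZ. Qed.

Lemma normc_real (x : R) : normc x%:C = `|x|.
Proof. by rewrite /= expr0n/= addr0 sqrtr_sqr. Qed.

Lemma bnormZr (x : R) v : bnorm (x%:C *: v) = `|x| * bnorm v.
Proof. by rewrite bnormZ normc_real. Qed.

Lemma normc_ge0 a : 0 <= normc a.
Proof. by case: a => a b /=; rewrite sqrtr_ge0. Qed.

Lemma normcX a n : normc (a ^+ n) = normc a ^+ n.
Proof. by elim: n => [|n ih]; rewrite ?normc1// !exprS normcM ih. Qed.

(** The norm of [B] takes its values in [R[i]]; every estimate below is in terms
    of its real part [bnorm]. *)
Lemma cvg_bnormP T (F : set_system T) {FF : Filter F} (u : T -> B) v :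
  (u @ F --> v) <-> forall eps : R, 0 < eps -> \forall x \near F, bnorm (v - u x) < eps.
Proof.
split=> [/cvgrPdist_lt uv eps eps0|uv].
  have := uv eps%:C; rewrite ltcR => /(_ eps0); apply: filterS => x.
  by rewrite norm_bnorm ltcR.
apply/cvgrPdist_lt => eps eps0.
have Ee : eps = (complex.Re eps)%:C by rewrite RRe_real// gtr0_real.
have := uv (complex.Re eps); rewrite -ltcR -Ee => /(_ eps0).
by apply: filterS => x; rewrite -ltcR norm_bnorm -Ee.
Qed.

Lemma cvg_bnorm_le T (F : set_system T) {FF : ProperFilter F} (u : T -> B) v (b : R) :
  u @ F --> v -> (\forall x \near F, bnorm (u x) <= b) -> bnorm v <= b.
Proof.
move=> /cvg_bnormP uv ub; apply/ler_addgt0Pr => e e0.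
have [x [xv xb]] := filter_ex (filterI (uv e e0) ub).
have := ler_bnormD (v - u x) (u x); rewrite subrK => /le_trans; apply.
by rewrite addrC lerD// ltW.
Qed.

End bnorm.

(** * Finite differences *)

Section finite_difference.
Context {V W : zmodType}.

Definition fdiff (h : V) (g : V -> W) : V -> W := fun x => g (x + h) - g x.

Lemma fdiffn_ext h m (g g' : V -> W) : g =1 g' ->
  iter m (fdiff h) g =1 iter m (fdiff h) g'.
Proof. by move=> gg'; elim: m => //= m ih x; rewrite /fdiff !ih. Qed.

Lemma fdiffn_shift h m (g : V -> W) c x :
  iter m (fdiff h) (fun x => g (x + c)) x = iter m (fdiff h) g (x + c).
Proof. by elim: m x => //= m ih x; rewrite /fdiff !ih addrAC. Qed.

Lemma fdiffn_sum h m I (r : seq I) (P : pred I) (g : I -> V -> W) x :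
  iter m (fdiff h) (fun x => \sum_(i <- r | P i) g i x) x =
  \sum_(i <- r | P i) iter m (fdiff h) (g i) x.
Proof. by elim: m x => //= m ih x; rewrite /fdiff !ih -sumrB. Qed.

End finite_difference.

(** * Characters of the circle *)

Section expi.
Context {R : realType}.
Implicit Types (x y : R).

Definition expi x : R[i] := cos (x * (pi *+ 2)) +i* sin (x * (pi *+ 2)).

Lemma expi0 : expi 0 = 1.
Proof. by rewrite /expi mul0r cos0 sin0. Qed.

Lemma expiD x y : expi (x + y) = expi x * expi y.
Proof. by rewrite /expi mulrDl cosD sinD; congr (_ +i* _); ring. Qed.

Lemma expi_sum I (r : seq I) (P : pred I) (F : I -> R) :
  expi (\sum_(i <- r | P i) F i) = \prod_(i <- r | P i) expi (F i).
Proof. exact: (big_morph _ expiD expi0). Qed.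

Lemma normc_expi x : normc (expi x) = 1.
Proof. by rewrite /= cos2Dsin2 sqrtr1. Qed.

Lemma expi1 : expi 1 = 1.
Proof. by rewrite /expi mul1r cos2pi sin2pi. Qed.

Lemma expi_nat n x : expi (n%:R * x) = expi x ^+ n.
Proof.
elim: n => [|n ih]; first by rewrite mul0r expi0.
by rewrite -addn1 natrD mulrDl mul1r expiD ih addn1 exprSr.
Qed.

Lemma expi_natr n : expi n%:R = 1.
Proof. by rewrite -[n%:R]mulr1 expi_nat expi1 expr1n. Qed.

Lemma expiN x : expi x * expi (- x) = 1.
Proof. by rewrite -expiD subrr expi0. Qed.

Lemma expi_int (n : int) : expi n%:~R = 1.
Proof.
case: n => n; first exact: expi_natr.
by have := expiN n.+1%:R; rewrite expi_natr mul1r NegzE mulrNz.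
Qed.

Lemma normc_expiN_sub1 x : normc (expi (- x) - 1) = normc (expi x - 1).
Proof.
have -> : expi x - 1 = expi x * (1 - expi (- x)) by rewrite mulrBr mulr1 expiN.
by rewrite normcM normc_expi mul1r -normcN opprB.
Qed.

Lemma normc_expi_nat_sub1 n x : normc (expi (n%:R * x) - 1) <= n%:R * normc (expi x - 1).
Proof.
elim: n => [|n ih]; first by rewrite !mul0r expi0 subrr normc0.
have -> : expi (n.+1%:R * x) - 1 = expi x * (expi (n%:R * x) - 1) + (expi x - 1).
  by rewrite -addn1 natrD mulrDl mul1r expiD mulrBr mulr1 addrA subrK mulrC.
rewrite (le_trans (le_normcD _ _))// normcM normc_expi mul1r.
by rewrite -[n.+1]addn1 natrD mulrDl mul1r lerD2r.
Qed.

Lemma normc_expi_sub1_ge1 x : 4^-1 <= x <= 2^-1 -> 1 <= normc (expi x - 1).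
Proof.
move=> /andP[x4 x2]; set y := x * (pi *+ 2).
have pi0 := pi_gt0 R.
have c0 : cos y <= 0.
  have -> : y = (y - pi / 2) + pi / 2 by rewrite subrK.
  rewrite cosDpihalf oppr_le0 sin_ge0_pi// /y -mulr_natr; apply/andP; split; nra.
rewrite /= subr0 -{1}sqrtr1 ler_wsqrtr// -subr_ge0.
have := cos2Dsin2 y; rewrite -/y => ys; nra.
Qed.

(** Some multiple [n * x] lies in [[1/4, 1/2]], where the chord has length at least
    [1]; going from [x] to [n * x] multiplies the chord by at most [n]. *)
Lemma normc_expi_sub1_ge x : `|x| <= 2^-1 -> 2 * `|x| <= normc (expi x - 1).
Proof.
wlog x0 : x / 0 < x => [hw|].
  have [x0|x0|->] := ltrgt0P x; last by rewrite mulr0 normc_ge0.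
    by have := hw x x0; rewrite (gtr0_norm x0).
  move=> xl; rewrite -normc_expiN_sub1; have := hw (- x).
  by rewrite normrN oppr_gt0 (ltr0_norm x0); apply.
rewrite gtr0_norm// => xl.
pose n := Num.truncn (2 * x)^-1.
have i0 : 0 <= (2 * x)^-1 by rewrite invr_ge0 mulr_ge0// ltW.
have /andP[n1 n2] := truncn_itv i0; rewrite -/n in n1 n2.
have i1 : (2 * x)^-1 * (2 * x) = 1 by rewrite mulVf// mulf_neq0 ?gt_eqF.
have n0 : (0 < n)%N.
  rewrite lt0n; apply/eqP => n0; move: n2; rewrite n0; nra.
have n0' : 1 <= n%:R :> R by rewrite ler1n.
have := normc_expi_nat_sub1 n x.
have /normc_expi_sub1_ge1 h : 4^-1 <= n%:R * x <= 2^-1.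
  rewrite -natr1 in n2.
  have := ler_wpM2r (ltW (mulr_gt0 (ltr0Sn R 1) x0)) n1.
  have := ler_wpM2r (ltW (mulr_gt0 (ltr0Sn R 1) x0)) (ltW n2).
  rewrite i1 => h1 h2; have h3 := ler_wpM2r (ltW x0) n0'.
  apply/andP; split; lra.
move=> /(le_trans h) h'; have c0 := normc_ge0 (expi x - 1).
by rewrite -(ler_pM2l (_ : 0 < n%:R)) ?ltr0n//; nra.
Qed.

(** Translating [x] by the nearest integer does not change [expi x]. *)
Lemma normc_expi_sub1_ge_dist x (delta : R) :
  (forall n : int, delta <= `|x - n%:~R|) -> 2 * delta <= normc (expi x - 1).
Proof.
move=> xd; pose n := Num.floor (x + 2^-1).
have -> : expi x = expi (x - n%:~R).
  by rewrite expiD -mulrNz expi_int mulr1.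
rewrite (le_trans _ (normc_expi_sub1_ge _)) ?ler_pM2l//.
have /andP[] := floor_itv (x + 2^-1); rewrite -/n intrD1 => n1 n2.
by rewrite ler_norml; apply/andP; split; lra.
Qed.

Lemma lipschitz1 (g dg : R -> R) x y : (forall z : R, is_derive z 1 g (dg z)) ->
  (forall z, `|dg z| <= 1) -> `|g x - g y| <= `|x - y|.
Proof.
move=> gd dg1; wlog yx : x y / y <= x => [hw|].
  have [/hw//|/ltW/hw] := leP y x.
  by rewrite distrC (distrC x).
have gc : {within `[y, x], continuous g}.
  apply/continuous_subspaceT => z.
  by apply/differentiable_continuous/derivable1_diffP; case: (gd z).
have [c _ ->] := MVT_segment yx (fun z _ => gd z) gc.
by rewrite normrM ler_piMl.
Qed.

Lemma normc_expi_sub1_le x : normc (expi x - 1) <= 4 * pi * `|x|.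
Proof.
set y := x * (pi *+ 2); have pi0 := pi_gt0 R.
have hc : `|cos y - 1| <= `|y|.
  rewrite -[X in cos y - X]cos0 -[X in _ <= `|X|]subr0.
  by apply: (lipschitz1 (dg := fun z => - sin z)) => z; rewrite normrN sin_max.
have hs : `|sin y| <= `|y|.
  rewrite -[sin y]subr0 -[X in sin y - X]sin0 -[X in _ <= `|X|]subr0.
  by apply: (lipschitz1 (dg := cos)) => z; exact: cos_max.
have -> : expi x - 1 = (cos y - 1)%:C + (0 +i* sin y).
  by rewrite /expi -/y; apply/eqP; rewrite eq_complex/= ; apply/andP; split; apply/eqP; ring.
rewrite (le_trans (le_normcD _ _))// normc_real /= expr0n add0r sqrtr_sqr.
rewrite (le_trans (lerD hc hs))// /y normrM.
have -> : `|pi *+ 2| = pi *+ 2 :> R by rewrite ger0_norm// mulrn_wge0// ltW.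
by rewrite -mulr_natr; lra.
Qed.

End expi.

(** * Summation by parts *)

Section summation_by_parts.
Context {R : realType} {V : lmodType R[i]}.

(** Shifting the index of summation multiplies the sum by [expi (- x)] up to the
    boundary terms; if these cancel, each difference of the amplitude contributes
    one factor [expi (- x) - 1]. *)
Lemma sum_expi_fdiffn (g : R -> V) (h x y : R) (L m : nat) :
  (forall i, (i < m)%N -> expi (L%:R * x) *: iter i (fdiff h) g (y + L%:R * h)
                          = iter i (fdiff h) g y) ->
  \sum_(0 <= n < L) expi (n%:R * x) *: iter m (fdiff h) g (y + n%:R * h) =
  (expi (- x) - 1) ^+ m *: \sum_(0 <= n < L) expi (n%:R * x) *: g (y + n%:R * h).
Proof.
elim: m => [|m ih] bdry; first by rewrite scale1r.
rewrite exprS -scalerA -ih => [|i im]; last by apply: bdry; rewrite ltnW.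
rewrite iterS; set u := iter m (fdiff h) g.
rewrite /fdiff; under eq_bigr do rewrite scalerBr.
rewrite sumrB scalerBl scale1r; congr (_ - _).
transitivity (expi (- x) *: \sum_(1 <= n < L.+1) expi (n%:R * x) *: u (y + n%:R * h)).
  rewrite big_add1/= scaler_sumr; apply: eq_bigr => i _.
  rewrite scalerA -expiD -natr1.
  by congr (expi _ *: u _); ring.
congr (_ *: _); apply/(addrI (expi (0%:R * x) *: u (y + 0%:R * h))).
rewrite -big_ltn// big_nat_recr//= addrC; congr (_ + _).
by rewrite (bdry m)// !mul0r expi0 scale1r addr0.
Qed.

End summation_by_parts.

(** * Finite differences of smooth real functions *)

Section fdiff_smooth.
Context {R : realType}.

(** One application of the mean value theorem per difference, along the chain of
    derivatives [g 0], [g 1], ... *)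
Lemma fdiffn_le_derivn (g : nat -> R -> R) (m : nat) (a h D : R) : 0 <= h ->
  (forall i (x : R), is_derive x 1 (g i) (g i.+1 x)) ->
  (forall t, a <= t <= a + m%:R * h -> `|g m t| <= D) ->
  `|iter m (fdiff h) (g 0%N) a| <= h ^+ m * D.
Proof.
move=> h0; elim: m g D => [|m ih] g D gd gm.
  by rewrite expr0 mul1r gm// mul0r addr0 lexx.
rewrite iterSr exprSr -mulrA.
apply: (ih (fun i => fdiff h (g i))) => [i x|t /andP[ta tb]].
  have dgs : is_derive x 1 (g i \o shift h) (g i.+1 (x + h)).
    rewrite -[g i.+1 (x + h)]mulr1.
    exact: (is_derive1_comp (gd i (shift h x)) (is_derive_shift x 1 h)).
  exact: (is_deriveB dgs (gd i x)).
have th : t <= t + h by rewrite lerDl.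
have gc : {within `[t, t + h], continuous g m}.
  apply/continuous_subspaceT => z.
  by apply/differentiable_continuous/derivable1_diffP; case: (gd m z).
have [c cth Ec] := MVT_segment th (fun z _ => gd m z) gc.
rewrite /fdiff Ec addrAC subrr add0r normrM (ger0_norm h0) mulrC ler_wpM2l// gm//.
move: cth; rewrite in_itv/= => /andP[tc cth].
rewrite (le_trans ta)//= (le_trans cth)// -natr1 mulrDl mul1r addrA.
by rewrite lerD2r.
Qed.

Lemma bin_le_expn n m : ('C(n, m) <= 2 ^ n)%N.
Proof.
elim: n m => [|n ih] [|m] //; first by rewrite bin0 expn_gt0.
by rewrite binS expnS mul2n -addnn leq_add.
Qed.

(** The [m]-th derivative of [t ^+ n] is [m! 'C(n, m) t ^+ (n - m)], and
    ['C(n, m) <= 2 ^ n]. *)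
Lemma fdiffn_expr (n m : nat) (t h r : R) : 0 <= h -> 0 < r ->
  `|t| <= r -> `|t + m%:R * h| <= r ->
  `|iter m (fdiff h) (fun s => s ^+ n) t| <= h ^+ m * (m`!%:R * r ^- m * (2 * r) ^+ n).
Proof.
move=> h0 r0 tr thr.
have -> : iter m (fdiff h) (fun s => s ^+ n) t
          = iter m (fdiff h) (horner ('X^n)^`(0)) t.
  by apply: fdiffn_ext => s; rewrite derivn0 hornerXn.
apply: (@fdiffn_le_derivn (fun i => horner ('X^n)^`(i))) => // s /andP[ts st].
have {ts st} sr : `|s| <= r.
  rewrite ler_norml (le_trans _ ts) ?(le_trans st)//.
    by move: thr; rewrite ler_norml => /andP[].
  by move: tr; rewrite ler_norml => /andP[].
rewrite derivnXn hornerMn hornerXn.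
have [nm|mn] := ltnP n m.
  rewrite ffact_small// mulr0n normr0.
  by rewrite !mulr_ge0// ?invr_ge0 ?exprn_ge0// ?mulr_ge0// ltW.
have h1 : 'C(n, m)%:R <= 2 ^+ n :> R by rewrite -natrX ler_nat bin_le_expn.
have h2 : `|s| ^+ (n - m) <= r ^- m * r ^+ n.
  rewrite mulrC -expfB_cond ?gt_eqF//; first by rewrite lerXn2r// nnegrE ltW.
rewrite normrMn normrX -bin_ffact -[leLHS]mulr_natl natrM exprMn.
have := ler_pM (ler0n _ _) (exprn_ge0 (n - m) (normr_ge0 s)) h1 h2.
move=> /(ler_wpM2l (ler0n _ m`!)) h3.
by apply: le_trans (le_trans h3 _); rewrite le_eqVlt; apply/orP; left; apply/eqP; ring.
Qed.

End fdiff_smooth.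

(** * Gevrey bounds for the weight *)

Lemma leq_fact_mul a b : (a.+1`! * b.+1`! <= (a + b).+1`!)%N.
Proof.
elim: b => [|b ih]; first by rewrite addn0 muln1.
rewrite (factS b.+1) mulnCA addnS (factS (a + b).+1) leq_mul//.
by rewrite !ltnS leq_addl.
Qed.

Lemma fact_le_expn a : (a.+1`! <= a.+1 ^ a)%N.
Proof.
elim: a => // a ih; rewrite factS expnS leq_mul2l/= (leq_trans ih)//.
by case: a {ih} => // a; rewrite leq_exp2r.
Qed.

Section exp_inv.
Context {R : realType}.
Implicit Types (p : {poly R}) (u x : R).

Lemma exprn_expRN_le n u : 0 <= u -> u ^+ n * expR (- u) <= n`!%:R.
Proof.
move=> u0; rewrite expRN ler_pdivrMr ?expR_gt0//.
case: n => [|n]; first by rewrite expr0 fact0 mul1r -expR0 ler_expR.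
rewrite mulrC -ler_pdivrMr ?ltr0n ?fact_gt0//.
by rewrite (le_trans _ (expR_ge1Dxn n u0))// lerDr.
Qed.

(** Each monomial satisfies [u ^+ j * expR (- u) <= j`!]. *)
Lemma horner_expRN_le p n (c : R) u : 0 <= u -> (size p <= n.+1)%N ->
  (forall j, `|p`_j| <= c) ->
  `|expR (- u) * p.[u]| <= n.+1%:R * (c * n`!%:R).
Proof.
move=> u0 pn pc; rewrite (horner_coef_wide _ pn) mulr_sumr.
rewrite (le_trans (ler_norm_sum _ _ _))// -[n.+1 in leRHS]card_ord -sum1_card natr_sum mulr_suml.
apply: ler_sum => i _; rewrite mul1r mulrCA normrM ler_pM//.
rewrite ger0_norm ?mulr_ge0 ?expR_ge0 ?exprn_ge0// mulrC.
rewrite (le_trans (exprn_expRN_le _ u0))// ler_nat leq_fact//.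
by rewrite -ltnS ltn_ord.
Qed.

(** The [i]-th derivative of [exp (- 1 / x)] is [exp (- u) (expinv_poly i).[u]]
    with [u = 1 / x], as [d/dx = - u ^ 2 d/du]. *)
Fixpoint expinv_poly i : {poly R} :=
  if i is i'.+1 then 'X^2 * (expinv_poly i' - (expinv_poly i')^`()) else 1.

Lemma size_expinv_poly i : (size (expinv_poly i) <= (2 * i).+1)%N.
Proof.
elim: i => [|i ih] /=; first by rewrite size_poly1.
rewrite (leq_trans (size_polyMleq _ _))// size_polyXn/= mulnS addSn ltnS add2n.
rewrite ltnS (leq_trans (size_polyD _ _))// geq_max ih size_polyN.
by rewrite (leq_trans (size_poly _ _))// (leq_trans (leq_pred _)).
Qed.

(** From [i] to [i.+1] the largest coefficient grows at most by the factor
    [1 + 2 i], since the degree is at most [2 i]. *)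
Lemma coef_expinv_poly i j : `|(expinv_poly i)`_j| <= (2 * i).+1`!%:R.
Proof.
elim: i j => [|i ih] j /=; first by rewrite coef1; case: j => [|j] /=; rewrite ?normr1 ?normr0.
rewrite coefXnM; case: ltnP => j2; first by rewrite normr0.
rewrite coefB coef_deriv; set k := (j - 2)%N.
have [ki|ki] := leqP (2 * i).+1 k.+1.
  rewrite [(expinv_poly i)`_k.+1]nth_default ?mul0rn ?subr0.
    by rewrite (le_trans (ih _))// ler_nat leq_fact// ltnS leq_mul2l leqnSn.
  exact: leq_trans (size_expinv_poly i) _.
have h : `|(expinv_poly i)`_k.+1 *+ k.+1| <= (2 * i).+1`!%:R *+ k.+1.
  by rewrite normrMn lerMn2r ih orbT.
rewrite (le_trans (ler_normB _ _))// (le_trans (lerD (ih _) h))//.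
rewrite -mulrS -mulrnA ler_nat mulnC mulnS add2n (factS (2 * i).+2).
by rewrite leq_mul ?leq_fact//; lia.
Qed.

Definition expinv_derive i x : R :=
  if 0 < x then expR (- x^-1) * (expinv_poly i).[x^-1] else 0.

Lemma expinv_derive_le i x : `|expinv_derive i x| <= ((2 * i).+1`! ^ 2)%:R.
Proof.
rewrite /expinv_derive; case: ifPn => [x0|_]; last by rewrite normr0.
rewrite (le_trans (horner_expRN_le _ (size_expinv_poly i) (coef_expinv_poly i)))//.
  by rewrite invr_ge0 ltW.
by rewrite mulrCA -!natrM -factS.
Qed.

(** At the origin the exponential beats every power of [1 / x], so the difference
    quotients tend to [0]. *)
Lemma is_derive_expinv i x : is_derive x 1 (expinv_derive i) (expinv_derive i.+1 x).
Proof.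
have [x0|x0|->] := ltrgt0P x.
- apply: (@near_eq_is_derive _ _ _
    ((fun y => expR (- y^-1)) * (fun y => (expinv_poly i).[y^-1]))).
    near=> y; rewrite /expinv_derive ifT//; near: y; exact: lt_nbhsr.
  have xn0 : x != 0 by rewrite gt_eqF.
  have dV : is_derive x 1 (fun y : R => y^-1) (- x ^- 2).
    by rewrite -[- _]mulr1; exact: (@is_deriveV _ id _ _ _ xn0 (is_derive_id x 1)).
  have dN : is_derive x 1 (fun y : R => - y^-1) (x ^- 2).
    by rewrite -[x ^- 2]opprK; exact: is_deriveN.
  have dE := @is_derive1_comp _ expR (fun y => - y^-1) _ _ _ (is_derive_expR (- x^-1)) dN.
  have dP := @is_derive1_comp _ _ (fun y => y^-1) _ _ _ (is_derive_poly (expinv_poly i) x^-1) dV.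
  apply: (is_derive_eq (is_deriveM dE dP)) => /=.
  rewrite /expinv_derive x0 /= hornerM hornerXn hornerD hornerN -exprVn /GRing.scale/=.
  ring.
- apply: (@near_eq_is_derive _ _ _ (cst 0)).
    near=> y; rewrite /expinv_derive ifF//; apply/negbTE; rewrite -leNgt ltW//.
    by near: y; exact: lt_nbhsl.
  rewrite /expinv_derive ifF; first exact: is_derive_cst.
  by apply/negbTE; rewrite -leNgt ltW.

  (* the bound on [exp (- u) u ^ 2 (expinv_poly i).[u]], which makes
     [expinv_derive i] quadratically small at the origin *)
- pose C : R := (2 * i).+3%:R * ((2 * i).+1`!%:R * (2 * i).+2`!%:R).
  have C0 : 0 < C by rewrite !mulr_gt0// ltr0n ?fact_gt0.
  have Cp j : `|('X^2 * expinv_poly i)`_j| <= (2 * i).+1`!%:R.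
    by rewrite coefXnM; case: ifP => _; rewrite ?normr0 ?coef_expinv_poly.
  have Cs : (size ('X^2 * expinv_poly i)%R <= (2 * i).+3)%N.
    rewrite (leq_trans (size_polyMleq _ _))// size_polyXn/= addSn ltnS.
    by rewrite ltnS; exact: size_expinv_poly.
  have qle h : `|expinv_derive i h| <= C * `|h| ^+ 2.
    rewrite /expinv_derive; case: ifPn => [h0|_]; last first.
      by rewrite normr0 mulr_ge0 ?exprn_ge0// ltW.
    have hV : 0 <= h^-1 by rewrite invr_ge0 ltW.
    have := horner_expRN_le hV Cs Cp; rewrite -/C hornerM hornerXn mulrCA normrM.
    rewrite normrX (ger0_norm hV) (gtr0_norm h0).
    by rewrite exprVn mulrC ler_pdivrMr ?exprn_gt0.
  have e0 : expinv_derive i 0 = 0 by rewrite /expinv_derive ltxx.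
  have cv : (fun h : R => h^-1 *: ((expinv_derive i \o shift 0) (h *: (1:R)) - expinv_derive i 0))
      @ 0^' --> (0 : R).
    apply/cvgrPdist_le => e e0'; near=> h.
    rewrite sub0r normrN /= addr0 e0 subr0 [h *: 1]mulr1 normrM normfV.
    have hn0 : 0 < `|h| by rewrite normr_gt0; near: h; exact: nbhs_dnbhs_neq.
    rewrite mulrC ler_pdivrMr// (le_trans (qle h))//.
    rewrite expr2 mulrA ler_wpM2r// mulrC -ler_pdivlMr//.
    near: h; apply: dnbhs0_le; rewrite divr_gt0//.
  have -> : expinv_derive i.+1 0 = 0 by rewrite /expinv_derive ltxx.
  apply: DeriveDef; first by apply/cvg_ex; exists 0.
  exact: cvg_lim cv.
Unshelve. all: by end_near. Qed.

End exp_inv.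

Section weight_difference.
Context {R : realType}.
Implicit Types (F G : R -> R).

Lemma fdiffn_add (h : R) m F G x : iter m (fdiff h) (fun x => F x + G x) x =
  iter m (fdiff h) F x + iter m (fdiff h) G x.
Proof. by elim: m x => //= m ih x; rewrite /fdiff !ih; ring. Qed.

Lemma fdiffn_mull (h : R) m c F x : iter m (fdiff h) (fun x => c * F x) x =
  c * iter m (fdiff h) F x.
Proof. by elim: m x => //= m ih x; rewrite /fdiff !ih mulrBr. Qed.

Lemma fdiffn_rev (h : R) m F x : iter m (fdiff h) (fun x => F (1 - x)) x =
  (-1) ^+ m * iter m (fdiff h) F (1 - x - m%:R * h).
Proof.
elim: m x => [|m ih] x; first by rewrite expr0 mul1r mul0r subr0.
rewrite !iterS {1 3}/fdiff !ih -natr1 exprS.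
have -> : 1 - (x + h) - m%:R * h = 1 - x - (m%:R + 1) * h by ring.
have -> : 1 - x - m%:R * h = 1 - x - (m%:R + 1) * h + h by ring.
by ring.
Qed.

(** Leibniz rule in the form of a bound: the differences of two functions may be
    shifted independently, so that the induction closes. *)
Lemma fdiffn_mul_le (h : R) (D : nat -> R) F G : 0 <= h ->
  (forall i j, D i * D j <= D (i + j)%N) -> (forall i, 0 <= D i) ->
  (forall i x, `|iter i (fdiff h) F x| <= h ^+ i * D i) ->
  (forall i x, `|iter i (fdiff h) G x| <= h ^+ i * D i) ->
  forall m x, `|iter m (fdiff h) (fun x => F x * G x) x| <= h ^+ m * (2 ^+ m * D m).
Proof.
move=> h0 DD D0 DF DG m x.
pose P i j c := fun x => iter i (fdiff h) F x * iter j (fdiff h) G (x + c).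
suff : forall m i j c x, `|iter m (fdiff h) (P i j c) x| <=
    h ^+ (m + i + j) * (2 ^+ m * D (m + i + j)%N).
  move=> /(_ m 0%N 0%N 0 x); rewrite !addn0; apply: le_trans.
  by rewrite le_eqVlt (@fdiffn_ext _ _ _ _ _ (P 0%N 0%N 0)) ?eqxx// => y; rewrite /P /= addr0.
move=> {m x}; elim=> [|m ih] i j c x.
  rewrite expr0 mul1r add0n /= /P normrM.
  rewrite (le_trans (ler_pM _ _ (DF i x) (DG j (x + c))))//.
  by rewrite mulrACA -exprD ler_wpM2l// exprn_ge0.
rewrite iterSr (@fdiffn_ext _ _ _ _ _ (fun y => P i.+1 j (c + h) y + P i j.+1 c y)); last first.
  by move=> y; rewrite /P /= /fdiff [y + h + c]addrAC -addrA; ring.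
rewrite fdiffn_add (le_trans (ler_normD _ _))// (le_trans (lerD (ih _ _ _ _) (ih _ _ _ _)))//.
by rewrite !(addnS, addSn) [2 ^+ m.+1]exprS; apply/eqW; ring.
Qed.

(** The unnormalized weight, continuous on the whole line (whereas [bump] takes
    the value [1] at the end points). *)
Definition window (x : R) : R := expinv_derive 0 x * expinv_derive 0 (1 - x).

Lemma window_bump (x : R) : 0 < x < 1 -> window x = bump x.
Proof.
move=> /andP[x0 x1]; rewrite /window /expinv_derive /= subr_gt0 x0 x1 !hornerC.
rewrite !mulr1 -expRD /bump; congr expR.
by field; rewrite subr_eq0 !gt_eqF.
Qed.

Lemma window_eq0 (x : R) : ~~ (0 < x < 1) -> window x = 0.
Proof.
rewrite /window /expinv_derive subr_gt0 negb_and => /orP[]/negbTE ->.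
  by rewrite mul0r.
by rewrite mulr0.
Qed.

Lemma window_ge0 (x : R) : 0 <= window x.
Proof.
have [/window_bump ->|/window_eq0 ->//] := boolP (0 < x < 1).
exact: expR_ge0.
Qed.

Lemma weightE (x : R) : weight x =
  (\int[lebesgue_measure]_(s in `[0, 1]) bump s)^-1 * window x.
Proof.
rewrite /weight; case: ifPn => [/window_bump ->//|/window_eq0 ->].
by rewrite mulr0.
Qed.

Lemma weight_eq0 (x : R) : ~~ (0 < x < 1) -> weight x = 0.
Proof. by rewrite /weight => /negbTE ->. Qed.

(** The growth [m ^ (4 m)] of the [m]-th derivative fixes the absolute exponent
    [1 / 4].  It comes from the square of [(2 * m).+1`!] in [expinv_derive_le]: one
    factor bounds the coefficients of [expinv_poly m], the other the powers of
    [1 / x] against the exponential. *)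
Lemma fdiffn_window_le (h : R) m x : 0 <= h ->
  `|iter m (fdiff h) window x| <= h ^+ m * (2 ^+ m * ((2 * m).+1 ^ (4 * m))%:R).
Proof.
move=> h0; pose D i : R := ((2 * i).+1`! ^ 2)%:R.
have DF i y : `|iter i (fdiff h) (expinv_derive 0) y| <= h ^+ i * D i.
  by apply: fdiffn_le_derivn => // *; [exact: is_derive_expinv|exact: expinv_derive_le].
have DD i j : D i * D j <= D (i + j)%N.
  by rewrite -natrM ler_nat -expnMn leq_exp2r// mulnDr leq_fact_mul.
have DG i y : `|iter i (fdiff h) (fun y => expinv_derive 0 (1 - y)) y| <= h ^+ i * D i.
  by rewrite fdiffn_rev normrM normrX normrN1 expr1n mul1r DF.
rewrite (le_trans (fdiffn_mul_le h0 DD _ DF DG m x))//.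
rewrite ler_wpM2l ?exprn_ge0// ler_wpM2l ?exprn_ge0// ler_nat.
have -> : (4 * m = 2 * m * 2)%N by lia.
by rewrite expnM leq_exp2r// fact_le_expn.
Qed.

Lemma fdiffn_weight_le (h : R) m x : 0 <= h ->
  `|iter m (fdiff h) weight x| <=
    `|(\int[lebesgue_measure]_(s in `[0, 1]) bump s)^-1 : R| *
    (h ^+ m * (2 ^+ m * ((2 * m).+1 ^ (4 * m))%:R)).
Proof.
move=> h0; rewrite (fdiffn_ext _ _ weightE) fdiffn_mull normrM ler_wpM2l//.
exact: fdiffn_window_le.
Qed.

End weight_difference.

(** * Exponential sums with the smooth weight *)

Lemma fdiffn_eq0 {R : pzRingType} {W : zmodType} (h : R) i (g : R -> W) x :
  (forall l, (l <= i)%N -> g (x + l%:R * h) = 0) -> iter i (fdiff h) g x = 0.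
Proof.
elim: i x => [|i ih] x gx0; first by have := gx0 0%N isT; rewrite mul0r addr0.
rewrite iterS /fdiff (ih x) => [|l li]; last by rewrite gx0// leqW.
rewrite ih ?subr0// => l li.
by have := gx0 l.+1 li; rewrite -natr1 mulrDl mul1r [_ + h]addrC addrA.
Qed.

Section exponential_sum.
Context {R : realType}.

Lemma fdiffn_real_complex (h : R) m (g : R -> R) x :
  iter m (fdiff h) (fun t => (g t)%:C : R[i]^o) x = (iter m (fdiff h) g x)%:C.
Proof. by elim: m x => //= m ih x; rewrite /fdiff !ih rmorphB. Qed.

Definition weighted_sum (N : nat) (x : R) : R[i] :=
  \sum_(0 <= n < N) expi (n%:R * x) * (weight (n%:R / N%:R))%:C.

Local Notation Z := (`|(\int[lebesgue_measure]_(s in `[0, 1]) bump s)^-1 : R|).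

(** Starting the sum [m] steps before the support of the weight makes all boundary
    terms of [m] summations by parts vanish. *)
Lemma weighted_sum_parts (N m : nat) (x : R) : (0 < N)%N -> (m <= N)%N ->
  normc (expi x - 1) ^+ m * normc (weighted_sum N x) <=
  2 * N%:R * Z * ((2 * m).+1%:R ^+ 4 * 2 / N%:R) ^+ m.
Proof.
move=> N0 mN.
have N0' : N%:R != 0 :> R by rewrite pnatr_eq0 -lt0n.
pose h : R := N%:R^-1; pose y := - (m%:R * h); pose L := (N + m)%N.
have h0 : 0 <= h by rewrite invr_ge0.
pose g (t : R) : R[i]^o := (weight t)%:C.
have gE0 t : ~~ (0 < t < 1) -> g t = 0 by move=> t01; rewrite /g weight_eq0.
have yL : y + L%:R * h = 1 by rewrite /y /h /L natrD; field.
have bl i : (i < m)%N -> iter i (fdiff h) g y = 0.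
  move=> im; apply: fdiffn_eq0 => l li; apply: gE0; rewrite negb_and -leNgt.
  apply/orP; left; rewrite /y addrC -mulrBl mulr_le0_ge0// subr_le0 ler_nat.
  by rewrite (leq_trans li)// ltnW.
have br i : iter i (fdiff h) g (y + L%:R * h) = 0.
  apply: fdiffn_eq0 => l li; apply: gE0; rewrite yL negb_and -!leNgt.
  by apply/orP; right; rewrite lerDl mulr_ge0.
have := @sum_expi_fdiffn _ _ g h x y L m.
have -> : \sum_(0 <= n < L) expi (n%:R * x) *: g (y + n%:R * h)
        = expi (m%:R * x) * weighted_sum N x.
  rewrite (big_cat_nat _ (n := m))//=; last by rewrite /L leq_addl.
  rewrite big_nat_cond big1 ?add0r => [|n /andP[/andP[_ nm] _]]; last first.
    rewrite gE0 ?scaler0// negb_and -leNgt; apply/orP; left.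
    by rewrite /y addrC -mulrBl mulr_le0_ge0// subr_le0 ler_nat ltnW.
  rewrite -{1}[m]add0n big_addn /L addnK /weighted_sum mulr_sumr.
  apply: eq_bigr => n _; rewrite mulrA -expiD -mulrDl -natrD addnC.
  by congr (_ *: g _); rewrite /y natrD /h; ring.
move=> /(_ _) E; have {}E := E (fun i im => ltac:(by rewrite br scaler0 bl)).
rewrite -(normc_expiN_sub1 x) -normcX.
have -> : normc (weighted_sum N x) = normc (expi (m%:R * x) * weighted_sum N x).
  by rewrite normcM normc_expi mul1r.
rewrite -normcM -[_ * _]E.
have -> : 2 * N%:R * Z * ((2 * m).+1%:R ^+ 4 * 2 / N%:R) ^+ m =
   (2 * N%:R) * (Z * (h ^+ m * (2 ^+ m * ((2 * m).+1 ^ (4 * m))%:R))).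
  by rewrite natrX exprM !exprMn /h; ring.
apply: (@le_trans _ _ (\sum_(0 <= n < L)
  (Z * (h ^+ m * (2 ^+ m * ((2 * m).+1 ^ (4 * m))%:R))))); last first.
  rewrite sumr_const_nat subn0 -[leLHS]mulr_natl ler_wpM2r ?mulr_ge0 ?exprn_ge0//.
  by rewrite -natrM ler_nat /L mul2n -addnn leq_add2l.
rewrite (le_trans (_ : _ <= \sum_(0 <= n < L)
  normc (expi (n%:R * x) *: iter m (fdiff h) g (y + n%:R * h))))//.
  by elim/big_rec2 : _ => [|n u v _ uv]; rewrite ?normc0// (le_trans (le_normcD _ _))// lerD2l.
apply: ler_sum => n _.
by rewrite normcM normc_expi mul1r fdiffn_real_complex normc_real fdiffn_weight_le.
Qed.

(** [m] summations by parts give a bound of order [(m ^ 4 / (N delta)) ^ m], which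
    is about [exp (- m)] for [m] a small multiple of [(N delta) ^ (1 / 4)]. *)
Lemma weighted_sum_le : exists2 C : R, 0 < C & exists2 c : R, 0 < c &
  forall (N : nat) (x delta : R), (0 < N)%N -> 0 < delta ->
    (forall n : int, delta <= `|x - n%:~R|) ->
    normc (weighted_sum N x) <= N%:R * (C * expR (- c * (N%:R * delta) `^ 4^-1)).
Proof.
exists (2 * Z * expR 1 + 1); first by rewrite ltr_wpDl// !mulr_ge0// expR_ge0.
exists (3 * expR 1)^-1; first by rewrite invr_gt0 mulr_gt0// expR_gt0.
move=> N x delta N0 d0 xd.
have N0' : 0 < N%:R :> R by rewrite ltr0n.
have e1 : 1 <= expR 1 :> R by rewrite (le_trans _ (expR_ge1Dx _))// lerDl.
pose y := (N%:R * delta) `^ 4^-1.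
have y0 : 0 < y by rewrite powR_gt0// mulr_gt0.
have y4 : y ^+ 4 = N%:R * delta.
  by rewrite -powR_mulrn ?(ltW y0)// -powRrM mulVf// powRr1// ltW// mulr_gt0.
have d1 : delta <= 1.
  have /andP[f1 f2] := floor_itv x; rewrite intrD1 in f2.
  apply: (le_trans (xd (Num.floor x))); rewrite ger0_norm; lra.
(* since [2 m + 1 <= 3 m] for positive [m], this choice makes
   [(2 m + 1) ^ 4 / (N delta)] at most [exp (- 4)] *)
pose m := Num.truncn (y / (3 * expR 1)).
have e30 : 0 < 3 * expR 1 :> R by rewrite mulr_gt0// expR_gt0.
have /andP[m1 m2] : m%:R <= y / (3 * expR 1) < m.+1%:R.
  by rewrite truncn_itv// divr_ge0// ltW.
have m1' : m%:R * (3 * expR 1) <= y by rewrite -ler_pdivlMr.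
have mN : (m <= N)%N.
  rewrite -(ler_nat R).
  have my : m%:R <= y by have := ler0n R m; nra.
  have [yl1|y1] := leP y 1.
    by rewrite (le_trans my)// (le_trans yl1)// ler1n.
  have yN : y ^+ 4 <= N%:R by rewrite y4 ler_piMr// ltW.
  rewrite (le_trans my)// (le_trans _ yN)// exprS ler_peMr ?ltW//.
  by rewrite exprn_egt1.
have key : normc (weighted_sum N x) <= 2 * N%:R * Z * expR (- m%:R).
  have [m0|m0] := posnP m.
    have := @weighted_sum_parts N 0 x N0 isT.
    by rewrite !expr0 mul1r m0 oppr0 expR0.
  have cd := normc_expi_sub1_ge_dist xd.
  have := weighted_sum_parts x N0 mN.
  have d20 : 0 < 2 * delta by rewrite mulr_gt0.
  have : (2 * delta) ^+ m * normc (weighted_sum N x) <=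
     normc (expi x - 1) ^+ m * normc (weighted_sum N x).
    by rewrite ler_wpM2r ?normc_ge0// lerXn2r// nnegrE ?normc_ge0// ltW.
  move=> /le_trans h /h; rewrite mulrC -ler_pdivlMr ?exprn_gt0// => /le_trans; apply.
  rewrite -[leLHS]mulrA ler_wpM2l ?mulr_ge0// -exprVn -exprMn.
  rewrite -[- m%:R]mulr1 mulNr -mulrN expRM_natl lerXn2r ?nnegrE ?expR_ge0//.
    by rewrite !mulr_ge0 ?invr_ge0// ltW.
  rewrite expRN -[X in _ <= X^-1]mulr1.
  rewrite [leLHS](_ : _ = (2 * m).+1%:R ^+ 4 / (y ^+ 4)); last first.
    by rewrite y4; field; rewrite !gt_eqF.
  rewrite mulr1 ler_pdivrMr ?exprn_gt0// mulrC ler_pdivlMr ?expR_gt0//.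
  have h3 : (2 * m).+1%:R <= 3 * m%:R :> R by rewrite -natrM ler_nat; lia.
  apply: (@le_trans _ _ ((3 * m%:R) ^+ 4 * expR 1 ^+ 4)).
    rewrite ler_pM ?exprn_ge0 ?expR_ge0//; first by rewrite lerXn2r ?nnegrE ?mulr_ge0.
    by rewrite -[leLHS]expr1 ler_weXn2l.
  rewrite -exprMn lerXn2r// ?nnegrE ?mulr_ge0 ?expR_ge0//; first exact: ltW.
  by rewrite -mulrA [X in X <= _]mulrCA.
rewrite (le_trans key)//.
have em : expR (- m%:R) <= expR 1 * expR (- (3 * expR 1)^-1 * y).
  by rewrite -expRD ler_expR -natr1 in m2 *; lra.
have := ler_wpM2l (_ : 0 <= 2 * N%:R * Z) em; rewrite !mulr_ge0// => /(_ isT) /le_trans; apply.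
have := expR_ge0 (- (3 * expR 1)^-1 * y); set E := expR (- _ * _) => E0.
have := normr_ge0 (\int[lebesgue_measure]_(s in `[0, 1]) bump s)^-1; nra.
Qed.

End exponential_sum.

(** * Approximation by trigonometric polynomials in one variable *)

Section analytic_bounds.
Context {R : realType} {V : lmodType R} {B : completeNormedModType R[i]}.

(** Real-analyticity in the direction [v], with radius and bound both governed
    by [A]: the derivatives satisfy [|f^(m)| <= A ^+ m.+1 * m!], expressed by
    differences over segments of length at most [1 / A]. *)
Definition analytic_diff (A : nat) (v : V) (f : V -> B) : Prop :=
  forall x m (h : R), 0 <= h -> m%:R * h <= A%:R^-1 ->
    bnorm (iter m (fdiff (h *: v)) f x) <= A%:R ^+ m.+1 * h ^+ m * m`!%:R.

Lemma analytic_diff_bounded A v f x : analytic_diff A v f -> bnorm (f x) <= A%:R.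
Proof.
move=> /(_ x 0%N 0 (lexx 0)); rewrite mul0r invr_ge0 ler0n => /(_ isT) /=.
by rewrite expr1 expr0 fact0 !mulr1.
Qed.

Lemma analytic_diff_lipschitz A v f x (h : R) : analytic_diff A v f ->
  0 <= h <= A%:R^-1 -> bnorm (f (x + h *: v) - f x) <= A%:R ^+ 2 * h.
Proof.
move=> Af /andP[h0 hA]; have := Af x 1%N h h0.
by rewrite mul1r => /(_ hA); rewrite expr1 factS fact0 !mulr1.
Qed.

End analytic_bounds.

Section dft.
Context {R : realType} {B : completeNormedModType R[i]}.
Implicit Types (g : R -> B) (k : int) (M : nat).

Definition dft M g k : B :=
  (M%:R^-1)%:C *: \sum_(0 <= l < M) expi (l%:R * - (k%:~R / M%:R)) *: g (l%:R / M%:R).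

Lemma bnorm_dft_le M g k (c : R) : (0 < M)%N -> (forall t, bnorm (g t) <= c) ->
  bnorm (dft M g k) <= c.
Proof.
move=> M0 gc; rewrite bnormZr ger0_norm ?invr_ge0// mulrC ler_pdivrMr ?ltr0n//.
rewrite (le_trans (ler_bnorm_sum _ _ _))// mulr_natr.
rewrite (le_trans (_ : _ <= \sum_(0 <= l < M) c))//; last by rewrite sumr_const_nat subn0.
by apply: ler_sum => l _; rewrite bnormZ normc_expi mul1r.
Qed.

(** [m] summations by parts give the bound [A (A / (2 |k|)) ^ m m!], which is at most
    [A 2 ^ (- m)] for [m = |k| / A]; the grid step cancels out. *)
Lemma bnorm_dft_decay A M g k : (0 < A)%N -> (2 * `|k| <= M)%N -> (0 < M)%N ->
  (forall t, g (t + 1) = g t) -> analytic_diff A (1 : R^o) g ->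
  bnorm (dft M g k) <= 2 * A%:R * expR (- (ln 2 / A%:R) * `|k|%:R).
Proof.
move=> A0 kM M0 g1 gA; set m := (`|k| %/ A)%N.
have A0' : 0 < A%:R :> R by rewrite ltr0n.
have M0' : 0 < M%:R :> R by rewrite ltr0n.
have mA : (m * A <= `|k|)%N by rewrite leq_divM.
suff h : bnorm (dft M g k) <= A%:R * 2 ^- m.
  rewrite (le_trans h)// -mulrA mulrCA ler_pM2l//.
  have -> : (2 : R) ^- m = expR (- (m%:R * ln 2)).
    by rewrite expRN expRM_natl lnK// posrE.
  rewrite -[X in X * expR _]lnK ?posrE// -expRD ler_expR.
  have : (`|k| <= m.+1 * A)%N by rewrite ltnW// -ltn_divLR.
  rewrite -(ler_nat R) natrM -ler_pdivrMr// -natr1 => h'.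
  have : 0 < ln (2 : R) by rewrite ln_gt0// ltr1n.
  nra.
have [k0|k0] := eqVneq k 0.
  rewrite /m k0 div0n expr0 invr1 mulr1.
  by apply: bnorm_dft_le => // t; exact: analytic_diff_bounded gA.
have k0' : 0 < `|k|%:R :> R by rewrite ltr0n absz_gt0.
pose x := - (k%:~R / M%:R) : R.
have gp : forall n t, g (t + n%:R) = g t.
  elim=> [|n ih] t; first by rewrite addr0.
  by rewrite -natr1 addrA g1 ih.
have bdry i : (i < m)%N -> expi (M%:R * x) *: iter i (fdiff M%:R^-1) g (0 + M%:R * M%:R^-1)
              = iter i (fdiff M%:R^-1) g 0.
  move=> _; have -> : M%:R * x = (- k)%:~R by rewrite /x rmorphN/= mulrN mulrC divfK// gt_eqF.
  rewrite expi_int scale1r mulfV ?gt_eqF// -fdiffn_shift.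
  exact: fdiffn_ext.
have E := sum_expi_fdiffn bdry.
have xk : `|- x| = `|k|%:R / M%:R.
  by rewrite /x opprK normrM normfV (ger0_norm (ltW M0')) natr_absz intr_norm.
have chord : 2 * (`|k|%:R / M%:R) <= normc (expi (- x) - 1).
  rewrite -xk; apply: normc_expi_sub1_ge; rewrite xk ler_pdivrMr//.
  by rewrite mulrC ler_pdivlMr// mulrC -natrM ler_nat.
have dftE : bnorm (\sum_(0 <= n < M) expi (n%:R * x) *: g (0 + n%:R * M%:R^-1))
          = M%:R * bnorm (dft M g k).
  rewrite bnormZr ger0_norm ?invr_ge0// mulrA mulfV ?gt_eqF// mul1r.
  by congr bnorm; apply: eq_bigr => n _; rewrite add0r.
have mM : m%:R * M%:R^-1 <= A%:R^-1 :> R.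
  rewrite ler_pdivrMr// mulrC ler_pdivlMr// -natrM ler_nat.
  by rewrite (leq_trans mA)// (leq_trans _ kM)// leq_pmull.
have upper : bnorm (\sum_(0 <= n < M) expi (n%:R * x) *:
      iter m (fdiff M%:R^-1) g (0 + n%:R * M%:R^-1))
    <= M%:R * (A%:R ^+ m.+1 * M%:R^-1 ^+ m * m`!%:R).
  rewrite (le_trans (ler_bnorm_sum _ _ _))//; set D := _ * m`!%:R.
  rewrite (_ : M%:R * D = \sum_(0 <= n < M) D); last by rewrite sumr_const_nat subn0 mulr_natl.
  apply: ler_sum => n _.
  rewrite bnormZ normc_expi mul1r.
  have := gA (0 + n%:R * M%:R^-1) m M%:R^-1; rewrite invr_ge0 ler0n => /(_ isT mM).
  by rewrite [_ *: 1]mulr1.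
move: upper; rewrite E bnormZ normcX dftE.
have := lerXn2r m _ _ chord; rewrite !nnegrE normc_ge0 !mulr_ge0 ?invr_ge0//.
move=> /(_ isT isT) chordm.
move=> upper; have := le_trans (ler_wpM2r _ chordm) upper.
move=> /(_ (mulr_ge0 (ler0n _ M) (bnorm_ge0 _))).
have mm : (A ^ m * m`! <= `|k| ^ m)%N.
  case: (m) mA => // n nA; rewrite (leq_trans _ (_ : ((n.+1 * A) ^ n.+1 <= _)%N)) ?leq_exp2r//.
  rewrite mulnC expnMn leq_mul2r; apply/orP; right.
  rewrite (leq_trans (fact_le_expn _))//.
  by rewrite leq_pexp2l.
have mm' : A%:R ^+ m * m`!%:R <= `|k|%:R ^+ m :> R by rewrite -!natrX -natrM ler_nat.
rewrite mulrCA ler_pM2l// exprMn expr_div_n exprVn.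
rewrite (_ : _ * _ * _ = (2 ^+ m * `|k|%:R ^+ m * bnorm (dft M g k)) * M%:R ^- m); last by ring.
rewrite (_ : A%:R ^+ m.+1 * _ * _ = A%:R * (A%:R ^+ m * m`!%:R) * M%:R ^- m); last first.
  by rewrite exprS; ring.
rewrite ler_pM2r ?invr_gt0 ?exprn_gt0// => /le_trans => /(_ _ (ler_wpM2l (ler0n _ A) mm')).
rewrite mulrAC ler_pM2r ?exprn_gt0// => h.
by rewrite ler_pdivlMr ?exprn_gt0// mulrC.
Qed.

Lemma sum_expi_root M (k : int) : (0 < M)%N -> ~~ (M %| `|k|)%N ->
  \sum_(0 <= j < M) expi (j%:R * (k%:~R / M%:R)) = 0 :> R[i].
Proof.
move=> M0 Mk; have M0' : M%:R != 0 :> R by rewrite pnatr_eq0 -lt0n.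
set x := k%:~R / M%:R; under eq_bigr do rewrite expi_nat.
have e1 : expi x - 1 != 0.
  apply/eqP => e0; have : 2 * M%:R^-1 <= normc (expi x - 1).
    apply: normc_expi_sub1_ge_dist => n.
    have -> : x - n%:~R = (k - n * M%:Z)%:~R / M%:R.
      by rewrite rmorphB/= rmorphM/= /x -!pmulrn; field.
    rewrite normrM normfV (ger0_norm (ler0n _ M)) ler_peMl ?invr_ge0//.
    rewrite -intr_norm -[1]/(1%:~R) ler_int -gtz0_ge1 normr_gt0.
    by apply: contra Mk; rewrite subr_eq0 => /eqP ->; rewrite abszM dvdn_mull.
  by rewrite e0 normc0 leNgt mulr_gt0// invr_gt0 ltr0n.
apply/(mulIf e1); rewrite mul0r big_mkord mulrC -subrX1 -expi_nat.
by rewrite /x mulrCA mulfV// mulr1 expi_int subrr.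
Qed.

(** Orthogonality of the [M] characters of the grid, the frequencies being taken
    symmetric around [0]. *)
Lemma dft_inversion g (L l : nat) : let M := (2 * L).+1 in (l < M)%N ->
  g (l%:R / M%:R) =
  \sum_(0 <= j < M) expi ((j%:Z - L%:Z)%:~R * (l%:R / M%:R)) *: dft M g (j%:Z - L%:Z).
Proof.
move=> M lM; have M0 : M%:R != 0 :> R by rewrite pnatr_eq0.
pose x (l' : nat) : R := (l%:R - l'%:R) / M%:R.
have expand j : expi ((j%:Z - L%:Z)%:~R * (l%:R / M%:R)) *: dft M g (j%:Z - L%:Z) =
   \sum_(0 <= l' < M) ((M%:R^-1)%:C * expi ((j%:Z - L%:Z)%:~R * x l')) *: g (l'%:R / M%:R).
  rewrite /dft scalerA mulrC -scalerA !scaler_sumr; apply: eq_bigr => l' _.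
  rewrite !scalerA -mulrA -expiD; congr ((_ * expi _) *: _).
  by rewrite /x; ring.
under eq_bigr do rewrite expand.
rewrite exchange_big/= (bigD1_seq l) ?iota_uniq ?mem_index_iota//= -scaler_suml.
rewrite [X in _ + X]big1_seq ?addr0 => [|l' /andP[l'l]]; last first.
  rewrite mem_index_iota => /andP[_ l'M]; rewrite -scaler_suml -mulr_sumr.
  suff -> : \sum_(0 <= j < M) expi ((j%:Z - L%:Z)%:~R * x l') = 0 by rewrite mulr0 scale0r.
  under eq_bigr do rewrite rmorphB/= mulrBl expiD.
  rewrite -mulr_suml; under eq_bigr do rewrite -pmulrn.
  have -> : x l' = (l%:Z - l'%:Z)%:~R / M%:R by rewrite rmorphB.
  rewrite sum_expi_root ?mul0r//; apply: contra l'l => /dvdnP[q].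
  move: (M) lM l'M => M' lM l'M h; apply/eqP.
  by case: q h => [|q]; [lia|rewrite mulSn; lia].
under eq_bigr do rewrite /x subrr mul0r mulr0 expi0 mulr1.
rewrite sumr_const_nat subn0.
have -> : (M%:R^-1)%:C *+ M = 1 :> R[i].
  by rewrite -rmorphMn/= -[_ *+ M]mulr_natr mulVf.
by rewrite scale1r.
Qed.

End dft.

Section trig_approx1.
Context {R : realType} {B : completeNormedModType R[i]}.
Implicit Types (g : R -> B) (K L M : nat).

Definition dft_poly M K g (t : R) : B :=
  \sum_(0 <= j < (2 * K).+1) expi ((j%:Z - K%:Z)%:~R * t) *: dft M g (j%:Z - K%:Z).

Lemma sum_geometric_le (q : R) n : 0 <= q < 1 ->
  \sum_(0 <= j < n) q ^+ j <= (1 - q)^-1.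
Proof.
move=> /andP[q0 q1]; have q1' : 0 < 1 - q by rewrite subr_gt0.
rewrite big_mkord -[leRHS]mul1r ler_pdivlMr// mulrC -opprB mulNr -subrX1 opprB.
by rewrite lerBlDr lerDl exprn_ge0.
Qed.

(** The coefficients decay like [exp (- 2 lam |k|)]: half of the exponent yields
    the factor [exp (- lam K)], the other half a convergent geometric series. *)
Lemma dft_poly_truncate A g (K L : nat) : (0 < A)%N -> (K <= L)%N ->
  (forall t, g (t + 1) = g t) -> analytic_diff A (1 : R^o) g ->
  let M := (2 * L).+1 in let lam := ln 2 / A%:R / 2 in
  forall t, bnorm (dft_poly M L g t - dft_poly M K g t) <=
    4 * A%:R * (1 - expR (- lam))^-1 * expR (- lam * K%:R).
Proof.
move=> A0 KL g1 gA M lam t.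
pose F k := expi (k%:~R * t) *: dft M g k.
have lam0 : 0 < lam by rewrite !divr_gt0 ?ln_gt0 ?ltr1n// ltr0n.
have q01 : 0 <= expR (- lam) < 1 by rewrite expR_ge0 expR_lt1 oppr_lt0.
have Fle (k : int) : (`|k| <= L)%N -> (K <= `|k|)%N ->
    bnorm (F k) <= 2 * A%:R * expR (- lam * K%:R) * expR (- lam) ^+ `|k|.
  move=> kL Kk; rewrite bnormZ normc_expi mul1r.
  rewrite (le_trans (bnorm_dft_decay A0 _ _ g1 gA))// ?leqW ?leq_mul2l//.
  rewrite -[leRHS]mulrA ler_wpM2l ?mulr_ge0// -expRM_natl -expRD ler_expR.
  rewrite (_ : ln 2 / A%:R = lam * 2); last by rewrite /lam divfK.
  have : K%:R <= `|k|%:R :> R by rewrite ler_nat.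
  nra.
have split3 : dft_poly M L g t = \sum_(0 <= j < L - K) F (j%:Z - L%:Z)
    + dft_poly M K g t + \sum_(L + K.+1 <= j < M) F (j%:Z - L%:Z).
  rewrite /dft_poly (big_cat_nat _ (n := (L - K)%N))//=; last by rewrite /M; lia.
  rewrite (big_cat_nat _ (m := (L - K)%N) (n := (L + K.+1)%N))//=; [|lia|rewrite /M; lia].
  rewrite addrA; congr (_ + _ + _).
  rewrite -{1}[(L - K)%N]add0n big_addn.
  rewrite (_ : L + K.+1 - (L - K) = (2 * K).+1)%N; last by lia.
  apply: eq_bigr => j _; congr (F _); lia.
have tail1 : bnorm (\sum_(0 <= j < L - K) F (j%:Z - L%:Z)) <=
    2 * A%:R * expR (- lam * K%:R) * (1 - expR (- lam))^-1.
  rewrite (le_trans (ler_bnorm_sum _ _ _))// big_nat_rev/= add0n.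
  apply: (@le_trans _ _ (\sum_(0 <= j < L - K)
      2 * A%:R * expR (- lam * K%:R) * expR (- lam) ^+ j)).
    rewrite !big_mkord; apply: ler_sum => -[j jL] _ /=.
    rewrite (le_trans (Fle _ _ _)) ?ler_wpM2l ?mulr_ge0 ?expR_ge0//; [lia|lia|].
    by rewrite ler_wiXn2l ?expR_ge0// ?ltW ?(andP q01).2//; lia.
  by rewrite -mulr_sumr ler_wpM2l ?sum_geometric_le// !mulr_ge0 ?expR_ge0.
have tail2 : bnorm (\sum_(L + K.+1 <= j < M) F (j%:Z - L%:Z)) <=
    2 * A%:R * expR (- lam * K%:R) * (1 - expR (- lam))^-1.
  rewrite (le_trans (ler_bnorm_sum _ _ _))// -{1}[(L + K.+1)%N]add0n big_addn.
  apply: (@le_trans _ _ (\sum_(0 <= j < M - (L + K.+1))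
      2 * A%:R * expR (- lam * K%:R) * expR (- lam) ^+ j)).
    rewrite !big_mkord; apply: ler_sum => -[j jL] _ /=; rewrite /M in jL.
    rewrite (le_trans (Fle _ _ _)) ?ler_wpM2l ?mulr_ge0 ?expR_ge0//; [lia|lia|].
    by rewrite ler_wiXn2l ?expR_ge0// ?ltW ?(andP q01).2//; lia.
  by rewrite -mulr_sumr ler_wpM2l ?sum_geometric_le// !mulr_ge0 ?expR_ge0.
rewrite split3 addrAC addrK.
rewrite (le_trans (ler_bnormD _ _))// (le_trans (lerD tail1 tail2))//.
by apply: eqW; ring.
Qed.

(** The approximant is the interpolation polynomial on a fine grid, truncated at
    [K].  Between grid points both functions are Lipschitz, which costs an error
    inversely proportional to the grid size [M].  That [M] depends on [A] and [K]
    only allows the lemma to be used for all sections of a function of several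
    variables at once. *)
Lemma trig_approx1 A : (0 < A)%N -> exists2 C : R, 0 < C & exists2 lam : R, 0 < lam &
  forall K, exists2 M, (0 < M)%N & forall g,
    (forall t, g (t + 1) = g t) -> analytic_diff A (1 : R^o) g ->
    forall t, bnorm (g t - dft_poly M K g t) <= C * expR (- lam * K%:R).
Proof.
move=> A0; have A0' : 0 < A%:R :> R by rewrite ltr0n.
pose lam : R := ln 2 / A%:R / 2.
have lam0 : 0 < lam by rewrite !divr_gt0 ?ln_gt0 ?ltr1n.
have q1 : expR (- lam) < 1 by rewrite expR_lt1 oppr_lt0.
pose C1 := 4 * A%:R * (1 - expR (- lam))^-1.
have C10 : 0 < C1 by rewrite !mulr_gt0 ?invr_gt0 ?subr_gt0.
exists (C1 + 1); first by rewrite addr_gt0.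
exists lam => // K; set E := expR (- lam * K%:R).
(* sum of the Lipschitz constants of [g] and of the truncated polynomial *)
pose S := A%:R ^+ 2 + (2 * K).+1%:R * (4 * pi * K%:R * A%:R) : R.
have pi0 := pi_ge0 R.
have S0 : 0 <= S by rewrite addr_ge0 ?exprn_ge0 ?mulr_ge0.
pose L := maxn (maxn A K) (Num.truncn (S / E)).+1.
have LA : (A <= L)%N by rewrite !leq_max leqnn.
have LS : ((Num.truncn (S / E)).+1 <= L)%N by rewrite !leq_max leqnn !orbT.
have LK : (K <= L)%N by rewrite !leq_max leqnn !orbT.
clearbody L; pose M := (2 * L).+1.
have AM : (A <= M)%N by rewrite /M; lia.
have M0 : 0 < M%:R :> R by rewrite ltr0n.
have SM : S / M%:R <= E.
  rewrite ler_pdivrMr// mulrC -ler_pdivrMr ?expR_gt0//.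
  rewrite ltW// (lt_le_trans (truncnS_gt _))// ler_nat (leq_trans LS)// /M; lia.
exists M => // g g1 gA.
have step t : 0 <= t < 1 -> bnorm (g t - dft_poly M K g t) <= (C1 + 1) * E.
  move=> /andP[t0 t1]; pose l := Num.truncn (M%:R * t).
  have /andP[l1 l2] : l%:R <= M%:R * t < l.+1%:R by rewrite truncn_itv// mulr_ge0// ltW.
  have lM : (l < M)%N.
    by rewrite -(ltr_nat R) (le_lt_trans l1)// gtr_pMr.
  pose s := t - l%:R / M%:R.
  have s0 : 0 <= s by rewrite subr_ge0 ler_pdivrMr// mulrC.
  have sM : s <= M%:R^-1.
    rewrite lerBlDr -[X in X + _]mul1r -mulrDl addrC natr1 ler_pdivlMr// mulrC.
    exact: ltW.
  have tE : t = l%:R / M%:R + s by rewrite addrC subrK.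
  have MA : M%:R^-1 <= A%:R^-1 :> R by rewrite lef_pV2 ?posrE// ler_nat.
  have h1 : bnorm (g t - g (l%:R / M%:R)) <= A%:R ^+ 2 * s.
    rewrite tE -[s in g (_ + s)]mulr1; apply: (analytic_diff_lipschitz _ gA).
    by rewrite s0 (le_trans sM).
  have h2 : bnorm (g (l%:R / M%:R) - dft_poly M K g (l%:R / M%:R)) <= C1 * E.
    rewrite {1}(dft_inversion _ lM); exact: (dft_poly_truncate A0 LK g1 gA).
  have h3 : bnorm (dft_poly M K g (l%:R / M%:R) - dft_poly M K g t) <=
      (2 * K).+1%:R * (4 * pi * K%:R * A%:R) * s.
    rewrite /dft_poly -sumrB (le_trans (ler_bnorm_sum _ _ _))//.
    rewrite (_ : (2 * K).+1%:R * _ * s =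
      \sum_(0 <= j < (2 * K).+1) (4 * pi * K%:R * A%:R * s)); last first.
      by rewrite sumr_const_nat subn0 -[RHS]mulr_natl mulrA.
    rewrite !big_mkord; apply: ler_sum => -[j jK] _ /=.
    rewrite -scalerBl tE mulrDr expiD; set e := expi (_ * (l%:R / _)).
    pose k : int := j%:Z - K%:Z; rewrite -/k.
    have -> : e - e * expi (k%:~R * s) = e * - (expi (k%:~R * s) - 1) by ring.
    rewrite bnormZ normcM normc_expi mul1r normcN.
    rewrite (le_trans (ler_pM (normc_ge0 _) (bnorm_ge0 _) (normc_expi_sub1_le _)
      (bnorm_dft_le _ _ (fun t => analytic_diff_bounded t gA))))//.
    rewrite normrM (ger0_norm s0) -[leRHS]mulrA [A%:R * s]mulrC !mulrA ler_wpM2r//.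
    rewrite ler_wpM2r// ler_wpM2l ?mulr_ge0//.
    by rewrite -intr_norm [leRHS]pmulrn ler_int /k; move: jK; clear; lia.
  have -> : g t - dft_poly M K g t = (g t - g (l%:R / M%:R)) +
     (g (l%:R / M%:R) - dft_poly M K g (l%:R / M%:R)) +
     (dft_poly M K g (l%:R / M%:R) - dft_poly M K g t) by rewrite !addrA !subrK.
  rewrite (le_trans (ler_bnormD _ _))// (le_trans (lerD (ler_bnormD _ _) (lexx _)))//.
  rewrite (le_trans (lerD (lerD h1 h2) h3))//.
  have : S * s <= E by rewrite (le_trans _ SM)// ler_wpM2l.
  move=> Ss; apply: (@le_trans _ _ (C1 * E + S * s)); first by apply: eqW; rewrite /S; ring.
  by rewrite [leRHS]mulrDl mul1r lerD2l.
move=> t.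
rewrite -[t](subrK (Num.floor t)%:~R); set u := t - _; set z := Num.floor t.
have u01 : 0 <= u < 1.
  have /andP[] := floor_itv t; rewrite intrD1 => h1 h2.
  by rewrite subr_ge0 h1 ltrBlDl h2.
have gz : g (u + z%:~R) = g u.
  have gn (n : nat) x : g (x + n%:R) = g x.
    by elim: n x => [|n ih] x; rewrite ?addr0// -natr1 addrA g1.
  case: z => n; first exact: gn.
  by rewrite -[in RHS](subrK n.+1%:R u) gn NegzE rmorphN.
have pz : dft_poly M K g (u + z%:~R) = dft_poly M K g u.
  by apply: eq_bigr => j _; rewrite mulrDr -intrM expiD expi_int mulr1.
by rewrite gz pz step.
Qed.

End trig_approx1.

(** * Approximation by trigonometric polynomials in several variables *)

Section set_coord.
Context {R : realType} {d : nat}.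
Implicit Types (theta : 'rV[R]_d) (j l : 'I_d).

Definition set_coord theta j (t : R) : 'rV[R]_d :=
  \row_l if l == j then t else theta 0 l.

Lemma set_coord_id theta j : set_coord theta j (theta 0 j) = theta.
Proof. by apply/rowP => l; rewrite mxE; case: eqVneq => // ->. Qed.

Lemma set_coordD theta j (t h : R) :
  set_coord theta j t + h *: delta_mx 0 j = set_coord theta j (t + h).
Proof.
apply/rowP => l; rewrite !mxE eqxx /=.
by case: eqVneq => // _; rewrite ?mulr1 ?mulr0 ?addr0.
Qed.

Lemma set_coord_same theta j (t h : R) :
  set_coord (theta + h *: delta_mx 0 j) j t = set_coord theta j t.
Proof.
apply/rowP => l; rewrite !mxE eqxx /=.
by case: eqVneq => // _; rewrite mulr0 addr0.
Qed.

Lemma set_coord_other theta j l (t h : R) : l != j ->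
  set_coord (theta + h *: delta_mx 0 l) j t = set_coord theta j t + h *: delta_mx 0 l.
Proof.
move=> lj; apply/rowP => i; rewrite !mxE eqxx /=.
by case: (eqVneq i j) => // ->; rewrite eq_sym (negbTE lj) mulr0 addr0.
Qed.

Lemma set_coord_lattice theta j (t : R) (m : 'rV[int]_d) :
  set_coord (theta + lattice m) j t =
  set_coord theta j t + lattice (\row_l if l == j then 0 else m 0 l).
Proof.
by apply/rowP => i; rewrite !mxE; case: (eqVneq i j) => // _; rewrite addr0.
Qed.

End set_coord.

Section dot.
Context {R : realType} {d : nat}.
Implicit Types (theta : 'rV[R]_d) (k : 'rV[int]_d).

Lemma dotD k k' theta : dot (k + k') theta = dot k theta + dot k' theta.
Proof. by rewrite -big_split; apply: eq_bigr => j _; rewrite mxE rmorphD mulrDl. Qed.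

Lemma dot_delta (a : int) j theta : dot (a *: delta_mx 0 j) theta = a%:~R * theta 0 j.
Proof.
rewrite /dot (bigD1 j)//= big1 ?addr0 => [|l lj]; last first.
  by rewrite !mxE eqxx (negbTE lj) mulr0 mul0r.
by rewrite !mxE !eqxx mulr1.
Qed.

Lemma dotDr k theta theta' : dot k (theta + theta') = dot k theta + dot k theta'.
Proof. by rewrite -big_split; apply: eq_bigr => j _; rewrite mxE mulrDr. Qed.

Lemma dotZr k (a : R) theta : dot k (a *: theta) = a * dot k theta.
Proof. by rewrite mulr_sumr; apply: eq_bigr => j _; rewrite mxE mulrCA. Qed.

Lemma dot0 theta : dot 0 theta = 0.
Proof. by rewrite /dot big1// => j _; rewrite mxE mul0r. Qed.

End dot.

Section trig_approx.
Context {R : realType} {d : nat} {B : completeNormedModType R[i]}.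
Implicit Types (f : 'rV[R]_d -> B) (theta : 'rV[R]_d) (s : seq ('rV[int]_d * B)).

Definition trig_poly s theta : B := \sum_(p <- s) expi (dot p.1 theta) *: p.2.

Definition torus_analytic_diff (A : nat) f :=
  torus_periodic f /\ forall j : 'I_d, analytic_diff A (delta_mx 0 j : 'rV[R]_d) f.

Definition coord_dft M f (j : 'I_d) (k : int) theta : B :=
  dft M (fun t => f (set_coord theta j t)) k.

Lemma coord_section A f theta (j : 'I_d) : torus_analytic_diff A f ->
  let g t := f (set_coord theta j t) in
  (forall t, g (t + 1) = g t) /\ analytic_diff A (1 : R^o) g.
Proof.
move=> [fp fA] g; split=> [t|t m h h0 hA].
  rewrite /g -set_coordD -(fp (set_coord theta j t) (delta_mx 0 j)).
  by congr (f (_ + _)); apply/rowP => i; rewrite !mxE mul1r; case: andb.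
have -> : iter m (fdiff (h *: (1 : R^o))) g t
        = iter m (fdiff (h *: delta_mx 0 j)) f (set_coord theta j t).
  elim: m t {hA} => //= m ih t; rewrite /fdiff !ih set_coordD.
  by rewrite [h *: 1]mulr1.
exact: fA.
Qed.

(** An average of sections with weights of modulus [1] inherits the bounds. *)
Lemma coord_dft_analytic A M f (j : 'I_d) k : (0 < M)%N -> torus_analytic_diff A f ->
  torus_analytic_diff A (coord_dft M f j k).
Proof.
move=> M0 [fp fA]; split=> [theta m|l theta m h h0 hA].
  by congr (_ *: _); apply: eq_bigr => i _; rewrite set_coord_lattice fp.
have dftE : iter m (fdiff (h *: delta_mx 0 l)) (coord_dft M f j k) theta =
  (M%:R^-1)%:C *: \sum_(0 <= i < M) expi (i%:R * - (k%:~R / M%:R)) *: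
    iter m (fdiff (h *: delta_mx 0 l)) (fun th => f (set_coord th j (i%:R / M%:R))) theta.
  elim: m theta {hA} => //= m ih theta; rewrite {1}/fdiff !ih -scalerBr -sumrB.
  by congr (_ *: _); apply: eq_bigr => i _; rewrite -scalerBr.
rewrite dftE bnormZr ger0_norm ?invr_ge0// mulrC ler_pdivrMr ?ltr0n//.
rewrite (le_trans (ler_bnorm_sum _ _ _))//; set D := _ * m`!%:R.
have D0 : 0 <= D by rewrite !mulr_ge0 ?exprn_ge0.
rewrite [leRHS]mulrC -sumr_nat_cst; apply: ler_sum => i _.
rewrite bnormZ normc_expi mul1r.
have [->|lj] := eqVneq l j.
  case: m @D D0 hA {dftE} => [|m] D D0 hA; first exact: (fA j (set_coord theta j _) 0%N h h0 hA).
  rewrite iterSr (@fdiffn_ext _ _ _ _ _ (fun=> 0)); last first.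
    by move=> th; rewrite /fdiff set_coord_same subrr.
  have -> : iter m (fdiff (h *: delta_mx 0 j)) (fun=> 0) theta = 0 :> B.
    by elim: m {D D0 hA} theta => //= m ih theta; rewrite /fdiff !ih subrr.
  by rewrite bnorm0.
have -> : iter m (fdiff (h *: delta_mx 0 l)) (fun th => f (set_coord th j (i%:R / M%:R))) theta
   = iter m (fdiff (h *: delta_mx 0 l)) f (set_coord theta j (i%:R / M%:R)).
  elim: m theta {D D0 hA dftE} => //= m ih theta.
  by rewrite /fdiff !ih set_coord_other.
exact: fA.
Qed.

(** Induction on the number [n] of coordinates on which [f] depends: the discrete
    Fourier coefficients of [f] in the last of them satisfy the same bounds and
    depend on the others only. *)
Lemma trig_approx_coords A (C lam : R) K M : (0 < d)%N -> (0 < A)%N -> (0 < M)%N ->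
  0 < C ->
  (forall g : R -> B, (forall t, g (t + 1) = g t) -> analytic_diff A (1 : R^o) g ->
    forall t, bnorm (g t - dft_poly M K g t) <= C * expR (- lam * K%:R)) ->
  forall n f, (n <= d)%N -> torus_analytic_diff A f ->
  (forall theta theta', (forall l : 'I_d, (l < n)%N -> theta 0 l = theta' 0 l) ->
    f theta = f theta') ->
  exists s, [/\ forall p l, p \in s -> `|p.1 0 l| <= K%:Z,
    \sum_(p <- s) bnorm p.2 <= A%:R * (2 * K).+1%:R ^+ n &
    forall theta, bnorm (f theta - trig_poly s theta) <=
      n%:R * (2 * K).+1%:R ^+ n * (C * expR (- lam * K%:R)) ].
Proof.
move=> d0 A0 M0 C0 approx1.
(* the frequencies met so far vanish in the later coordinates, so that adding a
   frequency in direction [n] does not leave the box *)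
pose zero_from n s := forall p (l : 'I_d), p \in s -> (n <= l)%N -> p.1 0 l = 0.
suff : forall n f, (n <= d)%N -> torus_analytic_diff A f ->
  (forall theta theta', (forall l : 'I_d, (l < n)%N -> theta 0 l = theta' 0 l) ->
    f theta = f theta') ->
  exists s, zero_from n s /\ [/\ forall p l, p \in s -> `|p.1 0 l| <= K%:Z,
    \sum_(p <- s) bnorm p.2 <= A%:R * (2 * K).+1%:R ^+ n &
    forall theta, bnorm (f theta - trig_poly s theta) <=
      n%:R * (2 * K).+1%:R ^+ n * (C * expR (- lam * K%:R)) ].
  by move=> H n f nd fA fn; have [s [_ hs]] := H n f nd fA fn; exists s.
elim=> [|n ih] f nd fA fn.
  exists [:: (0, f 0)]; split; first by move=> p l; rewrite inE => /eqP -> _; rewrite mxE.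
  split=> [p l||theta].
  - by rewrite inE => /eqP ->; rewrite mxE normr0.
  - rewrite big_seq1/= expr0 mulr1; case: fA => _.
    by move=> fA; exact: analytic_diff_bounded (fA (Ordinal d0)).
  - rewrite /trig_poly big_seq1/= mul0r mul0r (fn theta 0)//.
    by rewrite dot0 expi0 scale1r subrr bnorm0.
pose j := Ordinal nd; pose Q : R := (2 * K).+1%:R.
pose c i := coord_dft M f j (i%:Z - K%:Z).
have cA i : torus_analytic_diff A (c i) by exact: coord_dft_analytic.
have cn i theta theta' : (forall l : 'I_d, (l < n)%N -> theta 0 l = theta' 0 l) ->
    c i theta = c i theta'.
  move=> tt'; congr (_ *: _); apply: eq_bigr => l _; congr (_ *: _).
  apply: fn => i' i'n; rewrite !mxE; case: eqVneq => // i'j; apply: tt'.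
  by rewrite ltn_neqAle -ltnS i'n andbT; apply: contra i'j => /eqP i'j; apply/eqP/val_inj.
have [S hS] := choice (fun i => ih (c i) (ltnW nd) (cA i) (cn i)).
pose shift_freq (i : nat) (p : 'rV[int]_d * B) : 'rV[int]_d * B :=
  (p.1 + (i%:Z - K%:Z) *: delta_mx 0 j, p.2).
pose s : seq ('rV[int]_d * B) :=
  flatten [seq map (shift_freq i) (S i) | i <- index_iota 0 (2 * K).+1].
have sP (p : 'rV[int]_d * B) : p \in s ->
    exists i, exists2 q, (i < (2 * K).+1)%N & q \in S i /\ p = shift_freq i q.
  case/allpairsPdep => i [q [iK qS ->]]; exists i, q => //.
  by move: iK; rewrite mem_index_iota.
exists s; split.
  move=> p l /sP [i [q _ [qS ->]]] nl; have [S0 _] := hS i.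
  rewrite !mxE eqxx /= (S0 q l qS) ?(ltnW nl)// add0r.
  case: eqVneq => [lj|_]; last by rewrite mulr0.
  by move: nl; rewrite lj ltnn.
have big_s (T : zmodType) (F : 'rV[int]_d * B -> T) : \sum_(p <- s) F p =
    \sum_(0 <= i < (2 * K).+1) \sum_(q <- S i) F (shift_freq i q).
  by rewrite /s big_allpairs_dep.
split=> [p l /sP [i [q iK [qS ->]]]||theta].
- have [S0 [SK _ _]] := hS i; rewrite !mxE eqxx /=.
  case: (eqVneq l j) => [->|_]; last by rewrite mulr0 addr0 SK.
  by rewrite (S0 q j qS)//= add0r mulr1; lia.
- rewrite big_s exprS mulrCA.
  apply: (@le_trans _ _ (\sum_(0 <= i < (2 * K).+1) A%:R * Q ^+ n)).
    by apply: ler_sum => i _; have [_ [_ Sb _]] := hS i.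
  by rewrite sumr_nat_cst.
have [g1 gA] := coord_section theta j fA.
have := approx1 _ g1 gA (theta 0 j); rewrite set_coord_id => h1.
set D := C * _ in h1 *; have D0 : 0 <= D by rewrite mulr_ge0 ?ltW ?expR_gt0.
have h2 : bnorm (dft_poly M K (fun t => f (set_coord theta j t)) (theta 0 j) - trig_poly s theta)
    <= Q * (n%:R * Q ^+ n * D).
  rewrite /trig_poly big_s -sumrB (le_trans (ler_bnorm_sum _ _ _))//.
  rewrite -sumr_nat_cst; apply: ler_sum => i _.
  rewrite (_ : _ - _ = expi ((i%:Z - K%:Z)%:~R * theta 0 j) *:
    (c i theta - trig_poly (S i) theta)).
    by rewrite bnormZ normc_expi mul1r; have [_ [_ _ Sa]] := hS i.
  rewrite scalerBr; congr (_ - _); rewrite scaler_sumr; apply: eq_bigr => q _ /=.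
  rewrite scalerA -expiD; congr (expi _ *: _).
  by rewrite dotD dot_delta addrC.
rewrite (le_trans (ler_bnorm_dist _ _ _) (le_trans (lerD h1 h2) _))//.
have Q1 : 1 <= Q ^+ n.+1 by rewrite exprn_ege1// ler1n.
rewrite -natr1 !mulrDl mul1r addrC lerD ?ler_peMl//.
by apply: eqW; rewrite exprS; ring.
Qed.

Lemma trig_approx A : (0 < A)%N -> (0 < d)%N ->
  exists2 C : R, 0 < C & exists2 lam : R, 0 < lam &
  forall K f, torus_analytic_diff A f -> 
  exists s, [/\ forall p l, p \in s -> `|p.1 0 l| <= K%:Z,
    \sum_(p <- s) bnorm p.2 <= A%:R * (2 * K).+1%:R ^+ d &
    forall theta, bnorm (f theta - trig_poly s theta) <=
      (2 * K).+1%:R ^+ d * (C * expR (- lam * K%:R)) ].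
Proof.
move=> A0 d0; have [C C0 [lam lam0 H]] := @trig_approx1 R B A A0.
exists (d%:R * C); first by rewrite mulr_gt0// ltr0n.
exists lam => // K f fA; have [M M0 HM] := H K.
have [|s [s1 s2 s3]] := trig_approx_coords d0 A0 M0 C0 HM (leqnn d) fA.
  by move=> th th' tt; congr f; apply/rowP => l; apply: tt.
exists s; split=> // theta; rewrite (le_trans (s3 theta))//.
by apply: eqW; ring.
Qed.

End trig_approx.

(** * Uniform bounds from local power series *)

Section multi_index.
Context {R : realType} {d : nat}.

Lemma ler_sum_uniq_sub (T : eqType) (s t : seq T) (F : T -> R) : uniq s -> uniq t ->
  {subset s <= t} -> (forall x, 0 <= F x) -> \sum_(x <- s) F x <= \sum_(x <- t) F x.
Proof.
move=> us ut st F0; rewrite [leRHS](bigID (fun x => x \in s))/= -[leLHS]addr0 lerD ?sumr_ge0//.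
rewrite -[leRHS]big_filter (perm_big [seq x <- t | x \in s])//.
apply: uniq_perm => //; first exact: filter_uniq.
by move=> x; rewrite mem_filter; case: (boolP (x \in s)) => // /st ->.
Qed.

(** Comparison with the sum over a box, which is a product of geometric sums. *)
Lemma sum_half_multi_index_le (s : seq {ffun 'I_d -> nat}) : uniq s ->
  \sum_(k <- s) \prod_(j < d) (2^-1 : R) ^+ k j <= 2 ^+ d.
Proof.
move=> us; pose L := (\max_(k <- s) \max_(j < d) k j).+1.
pose emb (f : {ffun 'I_d -> 'I_L}) : {ffun 'I_d -> nat} := [ffun j => val (f j)].
have emb_inj : injective emb.
  by move=> f f' /ffunP ff'; apply/ffunP => j; apply: val_inj; have := ff' j; rewrite !ffunE.
pose t := [seq emb f | f <- index_enum {ffun 'I_d -> 'I_L}].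
rewrite (le_trans (@ler_sum_uniq_sub _ _ t _ us _ _ _))//.
- by rewrite map_inj_uniq// index_enum_uniq.
- move=> k ks; apply/mapP.
  have kL j : (k j < L)%N.
    rewrite ltnS (leq_trans (leq_bigmax j))//.
    exact: (@leq_bigmax_seq _ s xpredT (fun k : {ffun 'I_d -> nat} => \max_(j < d) k j)%N).
  exists [ffun j => Ordinal (kL j)]; first exact: mem_index_enum.
  by apply/ffunP => j; rewrite !ffunE.
- by move=> k; apply: prodr_ge0 => j _; rewrite exprn_ge0// invr_ge0.
rewrite big_map (eq_bigr (fun f : {ffun 'I_d -> 'I_L} => \prod_j (2^-1 : R) ^+ f j)); last first.
  by move=> f _; apply: eq_bigr => j _; rewrite ffunE.
rewrite -(bigA_distr_bigA (fun (j : 'I_d) (i : 'I_L) => (2^-1 : R) ^+ i)) /=.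
rewrite -[d in leRHS]card_ord -prodr_const; apply: ler_prod => j _.
rewrite sumr_ge0/=; last by move=> i _; rewrite exprn_ge0// invr_ge0.
have := @sum_geometric_le R 2^-1 L; rewrite big_mkord => /(_ _)/le_trans; apply.
  by apply/andP; split; lra.
by rewrite (_ : 1 - 2^-1 = 2^-1) ?invrK//; field.
Qed.

End multi_index.

Section local_bounds.
Context {R : realType} {d : nat} {B : completeNormedModType R[i]}.
Implicit Types (f : 'rV[R]_d -> B) (theta : 'rV[R]_d) (k : {ffun 'I_d -> nat}).

Definition real_power_series (c : {ffun 'I_d -> nat} -> B) theta0 theta k : B :=
  (\prod_(j < d) (theta 0 j - theta0 0 j) ^+ k j)%:C *: c k.

#[local] Existing Instance totally_filter.

Lemma partial_sumE (I : choiceType) (W : zmodType) (x : I -> W) (J : {fset I}) :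
  partial_sum x J = \sum_(i <- enum_fset J) x i.
Proof. by rewrite big_seq_fsetE. Qed.

(** Outside a finite set, the term [i] is the difference of two partial sums that
    are both close to the limit. *)
Lemma cvg_term_bounded (I : choiceType) (x : I -> B) (v : B) :
  partial_sum x @ totally --> v -> exists2 C, 0 < C & forall i, bnorm (x i) <= C.
Proof.
move=> /cvg_bnormP/(_ 1 ltr01)[J _ JP].
have J0 : 0 <= \sum_(i <- enum_fset J) bnorm (x i) by apply: sumr_ge0 => i _; exact: bnorm_ge0.
exists (2 + \sum_(i <- enum_fset J) bnorm (x i)); first by rewrite ltr_wpDr.
move=> i; have [iJ|iJ] := boolP (i \in J).
  rewrite (big_fsetD1 i)//= addrCA lerDl addr_ge0//.
  by apply: sumr_ge0 => l _; exact: bnorm_ge0.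
have -> : x i = (v - partial_sum x J) - (v - partial_sum x (i |` J)%fset).
  by rewrite !partial_sumE big_fsetU1//= opprB [RHS]addrC subrKA addrK.
rewrite (le_trans (ler_bnormB _ _))// (le_trans (lerD (ltW (JP _ _)) (ltW (JP _ _))))//=.
- exact: fsubsetUr.
- by lra.
Qed.

Lemma cvg_fdiffn (T : Type) (F : set_system T) {FF : Filter F} (P : T -> 'rV[R]_d -> B)
    f v m x : (forall i, (i <= m)%N -> P ^~ (x + i%:R *: v) @ F --> f (x + i%:R *: v)) ->
  (fun t => iter m (fdiff v) (P t) x) @ F --> iter m (fdiff v) f x.
Proof.
elim: m x => [|m ih] x Pf; first by have := Pf 0%N isT; rewrite scale0r addr0.
rewrite iterS /fdiff; apply: cvgB; apply: ih => i im; last by apply: Pf; rewrite leqW.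
have -> : x + v + i%:R *: v = x + i.+1%:R *: v by rewrite -natr1 scalerDl scale1r addrA addrAC.
exact: Pf.
Qed.

(** On a polydisc four times smaller than one where the terms of the series are
    bounded, [fdiffn_expr] bounds the differences of the term [k] by a multiple of
    [2 ^ (- |k|)], and the sum over [k] converges. *)
Lemma analytic_at_local (F : 'rV[(R[i] : numFieldType)]_d -> B) f theta0 :
  (forall theta, F (real_point theta) = f theta) -> analytic_at F (real_point theta0) ->
  exists2 C : R, 0 < C & exists2 r : R, 0 < r & forall theta (j : 'I_d) m (h : R), 0 <= h ->
    (forall l, `|theta 0 l - theta0 0 l| <= r) -> `|theta 0 j + m%:R * h - theta0 0 j| <= r ->
    bnorm (iter m (fdiff (h *: delta_mx 0 j)) f theta) <= C * h ^+ m * m`!%:R * r ^- m.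
Proof.
move=> Ff [c].
move=> /nbhs_ballP[e /= e0 eP].
have Ee : e = (complex.Re e)%:C by rewrite RRe_real// gtr0_real.
pose eta := complex.Re e; have eta0 : 0 < eta by rewrite -ltcR -Ee.
have conv theta : (forall l, `|theta 0 l - theta0 0 l| < eta) ->
    partial_sum (real_power_series c theta0 theta) @ totally --> f theta.
  move=> tt; move: (eP (real_point theta)) => /=; rewrite Ff.
  have -> : (fun k : {ffun 'I_d -> nat} =>
      (\prod_(j < d) (real_point theta 0 j - real_point theta0 0 j) ^+ k j) *: c k)
    = real_power_series c theta0 theta.
    apply/funext => k; congr (_ *: _); rewrite rmorph_prod; apply: eq_bigr => j _.
    by rewrite !mxE rmorphXn/= rmorphB.
  apply; split=> // i l; rewrite ord1 !mxE /ball/= -rmorphB Ee.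
  rewrite normc_def /= expr0n addr0 sqrtr_sqr ltcR distrC.
  exact: tt.
pose rho := eta / 2; have rho0 : 0 < rho by rewrite divr_gt0.
have rhoeta : rho < eta by rewrite ltr_pdivrMr// ltr_pMr// ltr1n.
have [C C0 Cc] : exists2 C : R, 0 < C & forall k, \prod_(j < d) rho ^+ k j * bnorm (c k) <= C.
  pose theta1 := theta0 + const_mx rho.
  have [|C C0 CP] := cvg_term_bounded (conv theta1 _).
    by move=> l; rewrite !mxE addrAC subrr add0r ger0_norm// ltW.
  exists C => // k; have := CP k; rewrite bnormZr.
  rewrite (_ : \prod_j _ = \prod_(j < d) rho ^+ k j); last first.
    by apply: eq_bigr => j _; rewrite !mxE addrAC subrr add0r.
  by rewrite ger0_norm// prodr_ge0// => j _; rewrite exprn_ge0// ltW.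
have [r [rE r0]] : exists r, r = rho / 4 /\ 0 < r by exists (rho / 4); rewrite divr_gt0.
exists (C * 2 ^+ d); first by rewrite mulr_gt0// exprn_gt0.
exists r => // theta j m h h0 tr thr.
pose P J theta := partial_sum (real_power_series c theta0 theta) J.
have reta : r < eta by rewrite (le_lt_trans _ rhoeta)// rE; lra.
have Pf i : (i <= m)%N -> P ^~ (theta + i%:R *: (h *: delta_mx 0 j)) @ totally -->
    f (theta + i%:R *: (h *: delta_mx 0 j)).
  move=> im; apply: conv => l; rewrite !mxE eqxx /=; apply: le_lt_trans reta.
  have [->|_] := eqVneq l j; last by rewrite mulr0 mulr0 addr0 tr.
  rewrite mulr1 ler_norml; have := tr j; rewrite ler_norml => /andP[t1 _].
  move: thr; rewrite ler_norml => /andP[_ t2].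
  have : i%:R * h <= m%:R * h by rewrite ler_wpM2r// ler_nat.
  have : 0 <= i%:R * h by rewrite mulr_ge0.
  by move=> ? ?; apply/andP; split; lra.
apply: cvg_bnorm_le (cvg_fdiffn Pf) _; apply: nearW => J.
have fdQ k : iter m (fdiff (h *: delta_mx 0 j)) (fun th => real_power_series c theta0 th k) theta
    = (\prod_(l < d | l != j) (theta 0 l - theta0 0 l) ^+ k l *
       iter m (fdiff h) (fun t => t ^+ k j) (theta 0 j - theta0 0 j))%:C *: c k.
  elim: m (theta) {tr thr Pf} => [|m ih] th.
    by rewrite /= /real_power_series (bigD1 j)//= mulrC.
  rewrite !iterS {1}/fdiff !ih -scalerBl -rmorphB/=; congr (_%:C *: _).
  rewrite [in RHS]/fdiff mulrBr; congr (_ * _ - _).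
    by apply: eq_bigr => l lj; rewrite !mxE eqxx (negbTE lj) mulr0 addr0.
  by rewrite !mxE !eqxx mulr1 addrAC.
have -> : iter m (fdiff (h *: delta_mx 0 j)) (P J) theta =
    \sum_(k <- enum_fset J) iter m (fdiff (h *: delta_mx 0 j))
      (fun th => real_power_series c theta0 th k) theta.
  rewrite -fdiffn_sum; apply: fdiffn_ext => th; exact: partial_sumE.
rewrite (le_trans (ler_bnorm_sum _ _ _))//.
set D := h ^+ m * (m`!%:R * r ^- m).
have D0 : 0 <= D by rewrite !mulr_ge0 ?invr_ge0 ?exprn_ge0// ltW.
have term k : bnorm (iter m (fdiff (h *: delta_mx 0 j))
      (fun th => real_power_series c theta0 th k) theta)
    <= C * D * \prod_(l < d) 2^-1 ^+ k l.
  rewrite fdQ bnormZr normrM normr_prod.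
  have b1 : \prod_(l < d | l != j) `|(theta 0 l - theta0 0 l) ^+ k l| <=
      \prod_(l < d | l != j) (2 * r) ^+ k l.
    apply: ler_prod => l _; rewrite normr_ge0 normrX /=.
    apply: lerXn2r; rewrite ?nnegrE ?mulr_ge0 ?(ltW r0)//.
    by rewrite (le_trans (tr l))//; lra.
  have thr' : `|theta 0 j - theta0 0 j + m%:R * h| <= r by rewrite addrAC.
  have b2 := fdiffn_expr (k j) h0 r0 (tr j) thr'.
  have p0 : 0 <= \prod_(l < d | l != j) `|(theta 0 l - theta0 0 l) ^+ k l| by apply: prodr_ge0.
  apply: le_trans (ler_wpM2r (bnorm_ge0 _) (ler_pM p0 (normr_ge0 _) b1 b2)) _.
  have -> : \prod_(l < d | l != j) (2 * r) ^+ k l *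
      (h ^+ m * (m`!%:R * r ^- m * (2 * r) ^+ k j)) * bnorm (c k)
      = D * (\prod_(l < d) (2 * r) ^+ k l * bnorm (c k)).
    by rewrite [in RHS](bigD1 j)//= /D; ring.
  rewrite (mulrC C) -[leRHS]mulrA ler_wpM2l//.
  have -> : \prod_(l < d) (2 * r) ^+ k l = \prod_(l < d) rho ^+ k l * \prod_(l < d) 2^-1 ^+ k l.
    rewrite -big_split/=; apply: eq_bigr => l _; rewrite -exprMn rE; congr (_ ^+ _).
    by field.
  rewrite mulrAC ler_wpM2r//; apply: prodr_ge0 => l _; rewrite exprn_ge0// invr_ge0//.
rewrite (le_trans (ler_sum _ (fun k _ => term k)))// -mulr_sumr.
rewrite (_ : C * 2 ^+ d * h ^+ m * m`!%:R * r ^- m = C * D * 2 ^+ d); last by rewrite /D; ring.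
by rewrite ler_wpM2l ?sum_half_multi_index_le ?fset_uniq// mulr_ge0// ltW.
Qed.

(** The property [P n] below becomes weaker as [n] grows, so that it holds near
    each point for [n] large, and compactness of the cube makes [n] uniform. *)
Lemma torus_analytic_uniform f : torus_periodic f -> torus_analytic f ->
  exists2 A : nat, (0 < A)%N & torus_analytic_diff A f.
Proof.
move=> fp [U [F [_ Ureal _ FU Ff]]].
pose P (n : nat) theta := forall (j : 'I_d) m (h : R), 0 <= h -> m%:R * h <= n%:R^-1 ->
  bnorm (iter m (fdiff (h *: delta_mx 0 j)) f theta) <= n%:R ^+ m.+1 * h ^+ m * m`!%:R.
pose cube := [set theta : 'rV[R]_d | forall j, theta ord0 j \in `[0, 1]].
have cpt : compact cube by 
  apply: (@rV_compact _ _ (fun=> `[(0 : R), 1]%classic)) => _; exact: segment_compact.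
have : \forall n \near \oo, cube `<=` P n.
  have nc := iffLR (compact_near_coveringP cube) cpt.
  apply: (nc nat \oo P _) => theta0 _.
  have [C C0 [r r0 loc]] := analytic_at_local Ff (FU _ (Ureal theta0)).
  have r20 : 0 < r / 2 by rewrite divr_gt0.
  near=> theta n => j m h h0 hm.
  have n1 : 1 <= n%:R :> R by rewrite ler1n; near: n; exact: nbhs_infty_gt.
  have nC : C <= n%:R by near: n; exact: nbhs_infty_ger.
  have nr : r^-1 <= n%:R by near: n; exact: nbhs_infty_ger.
  have nr2 : (r / 2)^-1 <= n%:R by near: n; exact: nbhs_infty_ger.
  have n0 : 0 < n%:R :> R by rewrite (lt_le_trans ltr01).
  have hr : m%:R * h <= r / 2.
    by rewrite (le_trans hm)// -[leRHS]invrK lef_pV2// posrE invr_gt0.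
  have tt l : `|theta 0 l - theta0 0 l| <= r / 2.
    have : ball theta0 (r / 2) theta by near: theta; apply: nbhsx_ballx; exact: r20.
    by case=> _ /(_ ord0 l); rewrite /ball/= distrC => /ltW.
  rewrite (le_trans (loc theta j m h h0 _ _))//.
  - by move=> l; rewrite (le_trans (tt l))// ler_pdivrMr// ler_peMr ?ltW// ltr1n.
  - have := tt j; rewrite !ler_norml => /andP[t1 t2].
    have : 0 <= m%:R * h by rewrite mulr_ge0.
    by move=> ?; apply/andP; split; lra.
  have nm : r ^- m <= n%:R ^+ m.
    by rewrite -exprVn lerXn2r ?nnegrE ?invr_ge0// ltW.
  have : C * r ^- m <= n%:R ^+ m.+1.
    by rewrite exprS ler_pM// ?invr_ge0 ?exprn_ge0// ltW.
  move=> /(ler_wpM2r (mulr_ge0 (exprn_ge0 m h0) (ler0n _ m`!))) H.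
  by apply: le_trans (le_trans H _); apply: eqW; ring.
move=> [A0 _ /(_ (maxn A0 1) (leq_maxl _ _))]; set A := maxn A0 1 => cubeP.
exists A; first by rewrite leq_max orbT.
split=> // j theta m h h0 hA.
pose z : 'rV[int]_d := \row_l Num.floor (theta 0 l).
have -> : theta = (theta - lattice z) + lattice z by rewrite subrK.
rewrite -fdiffn_shift (@fdiffn_ext _ _ _ _ _ f) => [|th]; last exact: fp.
apply: cubeP => // l; rewrite /= in_itv/= !mxE.
have /andP[] := floor_itv (theta 0 l); rewrite intrD1 => z1 z2.
by rewrite subr_ge0 z1 lerBlDl ltW.
Unshelve. all: by end_near. Qed.

End local_bounds.

(** * Bochner integrals as limits of finite sums *)

Section finite_fibres.
Context d (T : measurableType d) {R : realType} (I : finType) (l : T -> I).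
Hypothesis ml : forall i, measurable (l @^-1` [set i]).

Lemma measurable_preimage_fibres (P : pred I) : measurable (l @^-1` [set i | P i]).
Proof.
rewrite (_ : _ @^-1` _ = \bigcup_(i in [set i | P i]) (l @^-1` [set i])).
  by apply: fin_bigcup_measurable => //; exact: finite_finset.
apply/seteqP; split => [x /= Px|x [i /= Pi lx]]; first by exists (l x).
by rewrite lx.
Qed.

Lemma measurable_fun_fibres (phi : I -> R) (D : set T) : measurable D ->
  measurable_fun D (phi \o l).
Proof.
move=> mD _ Y mY; apply: measurableI => //.
have -> : (phi \o l) @^-1` Y = l @^-1` [set i | phi i \in Y].
  by apply/seteqP; split => x /=; rewrite in_setE.
exact: measurable_preimage_fibres.
Qed.

Lemma ge0_integral_fibres (mu : {measure set T -> \bar R}) (D : set T) (phi : I -> R) :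
  measurable D -> (forall i, 0 <= phi i) ->
  (\int[mu]_(x in D) (phi (l x))%:E =
   \sum_i (phi i)%:E * mu (D `&` l @^-1` [set i]))%E.
Proof.
move=> mD phi0; transitivity (\int[mu]_(x in D)
    (\sum_i (phi i)%:E * (\1_(l @^-1` [set i]) x)%:E))%E.
  apply: eq_integral => x _; rewrite (bigD1 (l x))//= indicE mem_set// mule1.
  rewrite big1 ?adde0// => i il; rewrite indicE memNset ?mule0//=.
  by move=> /esym/eqP; rewrite (negbTE il).
rewrite ge0_integral_sum//; last first.
- by move=> i x _; rewrite mule_ge0 ?lee_fin.
- move=> i; apply: measurable_funeM; apply/measurable_EFinP.
  exact: measurable_indic.
apply: eq_bigr => i _; rewrite ge0_integralZl//.
- by rewrite integral_indic// setIC.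
- by apply/measurable_EFinP; exact: measurable_indic.
- by rewrite lee_fin.
Qed.

End finite_fibres.

Section simple_integral.
Context {R : realType} {B : completeNormedModType R[i]}.
Context d (T : measurableType d) (mu : {measure set T -> \bar R}) (D : set T).
Hypotheses (mD : measurable D) (muD : (mu D < +oo)%E).

Lemma fin_num_mu_setI (A : set T) : measurable A -> mu (D `&` A) \is a fin_num.
Proof.
move=> mA; rewrite ge0_fin_numE// (le_lt_trans _ muD)//.
by apply: le_measure => //; apply/mem_set => //; exact: measurableI.
Qed.

(** A value of [phi] that [phi \o l] does not take has empty fibres, hence
    coefficient [0]; this lets the sum run over all of [I]. *)
Lemma simple_integral_fibres (I : finType) (l : T -> I) (phi : I -> B) :
  (forall i, measurable (l @^-1` [set i])) ->
  simple_integral mu D (phi \o l) =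
  \sum_i (fine (mu (D `&` l @^-1` [set i])))%:C *: phi i.
Proof.
move=> ml; pose G i := fine (mu (D `&` l @^-1` [set i])).
have fr : finite_set (range (phi \o l)).
  apply: (@sub_finite_set _ _ (phi @` [set: I])); last exact: finite_image.
  by move=> _ [x _ <-]; exists (l x).
rewrite /simple_integral fsbig_finite//; set r := fset_set _.
have GE b : fine (mu (D `&` (phi \o l) @^-1` [set b])) = \sum_i (phi i == b)%:R * G i.
  have mb : measurable ((phi \o l) @^-1` [set b]).
    rewrite (_ : _ @^-1` _ = l @^-1` [set i | phi i == b]).
      exact: measurable_preimage_fibres.
    by apply/seteqP; split => x /= /eqP.
  have -> : mu (D `&` (phi \o l) @^-1` [set b]) =
      (\int[mu]_(x in D) ((fun i => (phi i == b)%:R) (l x))%:E)%E.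
    rewrite setIC -integral_indic//; apply: eq_integral => x _.
    rewrite indicE; congr ((nat_of_bool _)%:R%:E).
    by apply/idP/eqP => h; [exact: set_mem h|exact: mem_set h].
  rewrite (ge0_integral_fibres ml mu (phi := fun i => (phi i == b)%:R))//.
  rewrite -sum_fine => [|i _]; last by rewrite fin_numM// fin_num_mu_setI.
  by apply: eq_bigr => i _; rewrite fineM// fin_num_mu_setI.
under eq_bigr do rewrite GE rmorph_sum scaler_suml.
rewrite exchange_big/=; apply: eq_bigr => i _.
have [ir|ir] := boolP (phi i \in enum_fset r).
  rewrite (bigD1_seq (phi i)) ?fset_uniq//=; case: eqP => // _.
  rewrite mul1r big1 ?addr0// => b /eqP bi.
  by case: eqP => [ib|]; [case: bi|rewrite mul0r scale0r].
rewrite big1_seq => [|b /andP[_ br]]; last first.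
  case: eqP => [E|_]; last by rewrite mul0r scale0r.
  by rewrite E br in ir.
rewrite /G (_ : l @^-1` [set i] = set0) ?setI0 ?measure0 ?scale0r//.
apply/seteqP; split => // x /= lx; move: ir; rewrite /r in_fset_set// => /negP; apply.
by apply/mem_set; exists x => //=; rewrite lx.
Qed.

(** The map [l] sends [x] to the position of [(s x, s' x)] in an enumeration of the
    finitely many pairs of values.  With a common [l], sums of simple functions
    become pointwise operations. *)
Lemma integrable_simple_common (s s' : T -> B) :
  integrable_simple mu D s -> integrable_simple mu D s' ->
  exists n (l : T -> 'I_n.+1) (phi phi' : 'I_n.+1 -> B),
    [/\ forall i, measurable (l @^-1` [set i]), s = phi \o l & s' = phi' \o l].
Proof.
move=> [fs ms _] [fs' ms' _].
have /finite_seqP [L0 L0E] : finite_set (range s `*` range s') by exact: finite_setX.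
pose L := undup L0; pose g x := (s x, s' x).
have gL x : g x \in L.
  have : (range s `*` range s') (g x) by split; exists x.
  by rewrite L0E /= mem_undup.
have gi x : (index (g x) L < (size L).+1)%N by rewrite ltnS ltnW// index_mem.
pose z : B * B := (0, 0).
exists (size L), (fun x => Ordinal (gi x)), (fun i => (nth z L i).1), (fun i => (nth z L i).2).
split; last 2 first.
- by apply/funext => x /=; rewrite nth_index.
- by apply/funext => x /=; rewrite nth_index.
move=> i; have [iL|Li] := ltnP i (size L); last first.
  rewrite (_ : _ @^-1` _ = set0)//; apply/seteqP; split => // x /= /(congr1 val)/= xi.
  by move: Li; rewrite -xi leqNgt index_mem gL.
rewrite (_ : _ @^-1` _ = s @^-1` [set (nth z L i).1] `&` s' @^-1` [set (nth z L i).2]).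
  exact: measurableI.
apply/seteqP; split => x /= => [/(congr1 val)/= <-|[h h']]; first by rewrite nth_index.
apply: val_inj => /=; rewrite /g h h' -surjective_pairing index_uniq//.
exact: undup_uniq.
Qed.

Lemma simple_integral_dist (s s' : T -> B) :
  integrable_simple mu D s -> integrable_simple mu D s' ->
  measurable_fun D (fun x => bnorm (s x - s' x)) /\
  ((bnorm (simple_integral mu D s - simple_integral mu D s'))%:E <=
   \int[mu]_(x in D) (bnorm (s x - s' x))%:E)%E.
Proof.
move=> hs hs'; have [n [l [phi [phi' [ml -> ->]]]]] := integrable_simple_common hs hs'.
pose psi i := bnorm (phi i - phi' i); split.
  exact: (measurable_fun_fibres ml psi mD).
rewrite !simple_integral_fibres// -sumrB.
rewrite (ge0_integral_fibres ml mu (phi := psi))//; last by move=> i; exact: bnorm_ge0.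
apply: (@le_trans _ _ (\sum_i psi i * fine (mu (D `&` l @^-1` [set i])))%:E).
  rewrite lee_fin (le_trans (ler_bnorm_sum _ _ _))//; apply: ler_sum => i _.
  by rewrite -scalerBr bnormZr mulrC ger0_norm// fine_ge0.
rewrite -sumEFin; apply: lee_sum => i _; rewrite EFinM fineK//.
exact: fin_num_mu_setI.
Qed.

(** [bochner_integral] selects one of the possible values; all limits of simple
    integrals agree because their distance is at most the sum of the two
    approximation errors. *)
Lemma is_bochner_integral_unique (g : T -> B) v v' :
  is_bochner_integral mu D g v -> is_bochner_integral mu D g v' -> v = v'.
Proof.
move=> [s [hs ms s0 sv]] [s' [hs' ms' s0' sv']].
pose I1 n := (\int[mu]_(x in D) (bnorm (g x - s n x))%:E)%E.
pose I2 n := (\int[mu]_(x in D) (bnorm (g x - s' n x))%:E)%E.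
have I12 : (I1 n + I2 n)%E @[n --> \oo] --> (0 : \bar R)%E.
  by rewrite -[X in _ --> X](adde0 0%E); apply: cvgeD.
have dist0 n : ((bnorm (simple_integral mu D (s n) - simple_integral mu D (s' n)))%:E
    <= I1 n + I2 n)%E.
  have [mss /le_trans] := simple_integral_dist (hs n) (hs' n); apply.
  have /integrableP[m1 _] := ms n; have /integrableP[m2 _] := ms' n.
  rewrite /I1 /I2 -ge0_integralD//; first last.
  - by move=> x _; rewrite lee_fin bnorm_ge0.
  - by move=> x _; rewrite lee_fin bnorm_ge0.
  apply: ge0_le_integral => //.
  - by move=> x _; rewrite lee_fin bnorm_ge0.
  - exact/measurable_EFinP.
  - exact: emeasurable_funD.
  - by move=> x _; rewrite -EFinD lee_fin (bnormBC (g x)) ler_bnorm_dist.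
apply/eqP; rewrite -subr_eq0; apply/eqP/bnorm0_eq0/eqP.
rewrite eq_le bnorm_ge0 andbT; apply/ler_addgt0Pr => e e0; rewrite add0r.
apply: (cvg_bnorm_le (cvgB sv sv')).
have /fine_cvgP [I12fin /cvgrPdist_lt /(_ e e0) I12e] := I12.
near=> n.
have nf : (I1 n + I2 n)%E \is a fin_num by near: n.
have : `|0 - fine (I1 n + I2 n)%E| < e by near: n.
rewrite sub0r normrN => h; rewrite -lee_fin (le_trans (dist0 n))//.
by rewrite -(fineK nf) lee_fin ltW// (le_lt_trans (ler_norm _)).
Unshelve. all: by end_near. Qed.

(** The simple integrals form a Cauchy sequence by [simple_integral_dist].  The
    errors are measurable although [g] has no topological regularity: they are
    pointwise limits of distances between simple functions. *)
Lemma cvg_riemann_bochner (I : nat -> finType) (l : forall n, T -> I n)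
    (phi : forall n, I n -> B) (g : T -> B) (eps : nat -> R) :
  (forall n i, measurable (l n @^-1` [set i])) ->
  (forall n x, D x -> bnorm (g x - phi n (l n x)) <= eps n) ->
  eps @ \oo --> (0 : R) ->
  (fun n => \sum_i (fine (mu (D `&` l n @^-1` [set i])))%:C *: phi n i) @ \oo -->
    bochner_integral mu D g.
Proof.
move=> ml glE eps0.
pose s n := phi n \o l n.
have hs n : integrable_simple mu D (s n).
  have ms b : measurable (s n @^-1` [set b]).
    rewrite (_ : _ @^-1` _ = l n @^-1` [set i | phi n i == b]).
      exact: measurable_preimage_fibres.
    by apply/seteqP; split => x /= /eqP.
  split=> // [|b _]; last by rewrite -ge0_fin_numE// fin_num_mu_setI.
  apply: (@sub_finite_set _ _ (phi n @` [set: I n])); last exact: finite_image.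
  by move=> _ [x _ <-]; exists (l n x).
have SE n : simple_integral mu D (s n) =
    \sum_i (fine (mu (D `&` l n @^-1` [set i])))%:C *: phi n i.
  exact: simple_integral_fibres.
have mg n : measurable_fun D (fun x => bnorm (g x - s n x)).
  apply: (measurable_fun_cvg (h := fun m x => bnorm (s m x - s n x))) => [m|x Dx].
    by have [] := simple_integral_dist (hs m) (hs n).
  apply/cvgrPdist_le => e e0; move/cvgrPdist_le : eps0 => /(_ e e0); apply: filterS => m.
  rewrite sub0r normrN => em.
  have gm : bnorm (g x - s m x) <= e.
    by rewrite (le_trans (glE m x Dx))// (le_trans (ler_norm _)).
  have h1 := ler_bnorm_dist (s m x) (g x) (s n x).
  have h2 := ler_bnorm_dist (g x) (s m x) (s n x).
  rewrite (bnormBC (s m x) (g x)) in h2.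
  by rewrite ler_norml; apply/andP; split; lra.
pose m := fine (mu D).
have mE : mu D = m%:E by rewrite fineK// ge0_fin_numE.
have m0 : 0 <= m by rewrite fine_ge0.
have intle n : (\int[mu]_(x in D) (bnorm (g x - s n x))%:E <= (eps n * m)%:E)%E.
  rewrite EFinM -mE -(integral_cst mu mD (eps n)%:E); apply: ge0_le_integral => //.
  - by move=> x _; rewrite lee_fin bnorm_ge0.
  - exact/measurable_EFinP.
  - by move=> x Dx; rewrite lee_fin; exact: glE.
have integ n : mu.-integrable D (fun x => (bnorm (g x - s n x))%:E).
  apply/integrableP; split; first exact/measurable_EFinP.
  under eq_integral do rewrite gee0_abs ?lee_fin ?bnorm_ge0//.
  by rewrite (le_lt_trans (intle n))// ltry.
have SS n k : bnorm (simple_integral mu D (s n) - simple_integral mu D (s k)) <=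
    (eps n + eps k) * m.
  have [mss h] := simple_integral_dist (hs n) (hs k).
  rewrite -lee_fin (le_trans h)// EFinM -mE -(integral_cst mu mD (eps n + eps k)%:E).
  apply: ge0_le_integral => //.
  - by move=> x _; rewrite lee_fin bnorm_ge0.
  - exact/measurable_EFinP.
  - move=> x Dx; rewrite lee_fin (le_trans (ler_bnorm_dist (g x) _ _))// (bnormBC (s n x)).
    by rewrite lerD// glE.
have /cvg_ex [v Sv] : cvg ((fun n => simple_integral mu D (s n)) @ \oo).
  apply/cauchy_cvgP/cauchy_ballP => e e0.
  have Ee : e = (complex.Re e)%:C by rewrite RRe_real// gtr0_real.
  have re0 : 0 < complex.Re e by rewrite -ltcR -Ee.
  pose del := complex.Re e / (2 * (m + 1)).
  have del0 : 0 < del by rewrite divr_gt0// mulr_gt0// ltr_wpDl.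
  move/cvgrPdist_lt : eps0 => /(_ del del0) E0.
  have H : \forall n \near \oo, eps n < del.
    by apply: filterS E0 => n; rewrite sub0r normrN; apply: le_lt_trans; exact: ler_norm.
  near_simpl; near=> x y => /=.
  rewrite -ball_normE /ball_/= norm_bnorm Ee ltcR (le_lt_trans (SS _ _))//.
  have ex : eps x < del by near: x.
  have ey : eps y < del by near: y.
  have : (eps x + eps y) * m <= 2 * del * m by rewrite ler_wpM2r// mulr2n mulrDl mul1r lerD ?ltW.
  move=> /le_lt_trans; apply.
  have -> : 2 * del * m = (complex.Re e : R) * (m / (m + 1)).
    by rewrite /del; field; rewrite gt_eqF// ltr_wpDl.
  by rewrite gtr_pMr// ltr_pdivrMr ?mul1r ?ltrDl// ltr_wpDl.
have -> : (fun n => \sum_i (fine (mu (D `&` l n @^-1` [set i])))%:C *: phi n i) =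
    (fun n => simple_integral mu D (s n)) by apply/funext => n; rewrite SE.
have gv : is_bochner_integral mu D g v.
  exists s; split=> //; apply: (@squeeze_cvge _ _ _ _ (cst 0%E) _ (fun n => (eps n * m)%:E)).
  - by apply: nearW => n; rewrite integral_ge0 ?intle// => x _; rewrite lee_fin bnorm_ge0.
  - exact: cvg_cst.
  - apply: cvg_EFin; first exact: nearW.
    by rewrite -(mul0r m); apply: cvgMl.
rewrite /bochner_integral; case: xgetP => [_ -> /(is_bochner_integral_unique gv) <- //|].
by move=> /(_ v) /(_ gv).
Unshelve. all: by end_near. Qed.

End simple_integral.

(** * Riemann sums on the circle and on the torus *)

Section cells.
Context {R : realType}.
Local Notation mu := (@lebesgue_measure R).
Implicit Types (n : nat) (x t T : R).

(** Reducing the index of the cell modulo [n.+1] leaves finitely many values on the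
    whole line, so that step functions approximate a periodic function everywhere
    and not only on the fundamental domain. *)
Definition cell n x : 'I_n.+1 := inord `|(Num.floor (n.+1%:R * x) %% n.+1)%Z|%N.

Lemma cellP n x (i : 'I_n.+1) : cell n x = i <->
  exists z : int, z%:~R + i%:R / n.+1%:R <= x < z%:~R + i.+1%:R / n.+1%:R.
Proof.
have N0 : 0 < n.+1%:R :> R by [].
have itvE (z : int) : (z%:~R + i%:R / n.+1%:R <= x < z%:~R + i.+1%:R / n.+1%:R) =
    (Num.floor (n.+1%:R * x) == z * n.+1%:Z + i%:Z).
  rewrite floor_eq intrD1 rmorphD rmorphM/= -!pmulrn.
  congr (_ && _).
    by rewrite -(ler_pM2l N0) mulrDr mulrCA mulfV ?gt_eqF// mulr1 [_ * z%:~R]mulrC.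
  rewrite -(ltr_pM2l N0) mulrDr mulrCA mulfV ?gt_eqF// mulr1 [_ * z%:~R]mulrC.
  by rewrite -addrA natr1.
set fl := Num.floor _ in itvE *.
have cE : (cell n x : nat)%:Z = (fl %% n.+1)%Z.
  rewrite /cell inordK -/fl ?gez0_abs ?modz_ge0//.
  by rewrite -ltz_nat gez0_abs ?modz_ge0// ltz_pmod.
split=> [ci|[z]].
  exists (fl %/ n.+1)%Z; rewrite itvE; apply/eqP.
  by rewrite {1}(divz_eq fl n.+1) -cE ci.
rewrite itvE => /eqP flE; apply: val_inj; apply/eqP; rewrite -eqz_nat cE flE.
by rewrite modzMDl modz_small//= ltz_nat.
Qed.

Lemma cell_fibre n (T : R) (i : 'I_n.+1) : 0 < T ->
  (fun t => cell n (t / T)) @^-1` [set i] = \bigcup_(z in [set: int])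
    `[T * (z%:~R + i%:R / n.+1%:R), T * (z%:~R + i.+1%:R / n.+1%:R)[%classic.
Proof.
move=> T0; apply/seteqP; split=> t /=.
  move=> /cellP[z zt]; exists z => //=; rewrite in_itv/=.
  by move: zt; rewrite ler_pdivlMr// ltr_pdivrMr// ![_ * T]mulrC.
case=> z _; rewrite /= in_itv/= => zt; apply/cellP; exists z.
by rewrite ler_pdivlMr// ltr_pdivrMr// ![_ * T]mulrC.
Qed.

Lemma measurable_cell n (T : R) (i : 'I_n.+1) : 0 < T ->
  measurable ((fun t => cell n (t / T)) @^-1` [set i]).
Proof.
by move=> T0; rewrite cell_fibre//; apply: countable_bigcupT_measurable.
Qed.

Lemma cell_lt n (T t : R) : 0 < T -> 0 <= t -> t < T ->
  T * ((cell n (t / T))%:R / n.+1%:R) <= t < T * ((cell n (t / T)).+1%:R / n.+1%:R).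
Proof.
move=> T0 t0 tT; set i := cell n (t / T).
have [z] := (@cellP n (t / T) i).1 erefl.
rewrite ler_pdivlMr// ltr_pdivrMr// ![_ * T]mulrC => /andP[h1 h2].
have z0 : z = 0.
  have i1 : i.+1%:R / n.+1%:R <= 1 :> R by rewrite ler_pdivrMr// mul1r ler_nat.
  have i0 : 0 <= i%:R / n.+1%:R :> R by rewrite divr_ge0.
  have : z%:~R < 1 :> R.
    by rewrite -(ltr_pM2l T0) mulr1 (le_lt_trans _ tT)// (le_trans _ h1)// ler_pM2l// lerDl.
  have : -1 < z%:~R :> R.
    have : 0 < z%:~R + i.+1%:R / n.+1%:R :> R by rewrite -(pmulr_rgt0 _ T0) (le_lt_trans t0).
    by move=> h3; rewrite -subr_gt0 opprK (lt_le_trans h3)// lerD2l.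
  rewrite -[1]/(1%:~R) -rmorphN/= !ltr_int; lia.
by move: h1 h2; rewrite z0 !add0r => -> ->.
Qed.

(** The fibre is a half-open interval, except that the end point [T] wraps around
    to the cell [0]. *)
Lemma lebesgue_measure_cell n (T : R) (i : 'I_n.+1) : 0 < T ->
  mu (`[0, T] `&` (fun t => cell n (t / T)) @^-1` [set i]) = (T / n.+1%:R)%:E.
Proof.
move=> T0; have N0 : 0 < n.+1%:R :> R by [].
pose I := `[T * (i%:R / n.+1%:R), T * (i.+1%:R / n.+1%:R)[%classic.
have muI : mu I = (T / n.+1%:R)%:E.
  rewrite /I lebesgue_measure_itv/= lte_fin ltr_pM2l// ltr_pM2r ?invr_gt0//.
  by rewrite ltr_nat ltnSn -EFinB -mulrBr -mulrBl -natrB// subSnn mul1r.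
set S := _ `&` _.
have mS : measurable S by apply: measurableI => //; exact: measurable_cell.
have IS : I `<=` S.
  move=> t; rewrite /I /S /= in_itv/= => /andP[t1 t2]; split.
    rewrite in_itv/= (le_trans _ t1) ?mulr_ge0 ?divr_ge0 ?(ltW T0)//=.
    rewrite (le_trans (ltW t2))// ler_piMr ?(ltW T0)//.
    by rewrite ler_pdivrMr// mul1r ler_nat.
  apply/cellP; exists 0; rewrite !add0r ler_pdivlMr// ltr_pdivrMr// ![_ * T]mulrC.
  by rewrite t1.
have SI : S `<=` I `|` [set T].
  move=> t [/=]; rewrite in_itv/= => /andP[t0].
  rewrite le_eqVlt => /orP[/eqP ->|tT] ti; first by right.
  by left; rewrite /I /= in_itv/= -ti cell_lt.
apply/eqP; rewrite eq_le; apply/andP; split.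
  have mI : measurable I by exact: measurable_itv.
  rewrite (@le_trans _ _ (mu (I `|` [set T])))//.
    by apply: le_measure => //; apply/mem_set => //; exact: measurableU.
  apply: le_trans (measureU2 _ _ _) _ => //=.
  by rewrite [X in (_ + X)%E](_ : _ = 0%E) ?adde0 ?muI//; exact: lebesgue_measure_set1.
rewrite -muI; apply: le_measure => //; apply/mem_set => //.
exact: measurable_itv.
Qed.

Lemma uniform_probE (A : set R) : measurable A ->
  uniform_prob (@ltr01 R) A = mu (`[0, 1] `&` A).
Proof.
move=> mA; rewrite /uniform_prob integral_uniform_pdf.
transitivity (\int[mu]_(x in A `&` `[0%R, 1%R]) (cst 1%E x))%E.
  apply: eq_integral => x /set_mem [_ /=]; rewrite in_itv/= /uniform_pdf => ->.
  by rewrite subr0 invr1.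
by rewrite integral_cst ?mul1e 1?setIC//; exact: measurableI.
Qed.

End cells.

Section torus_cells.
Context {R : realType} {d : nat}.

Definition torus_cell n (x : d.-tuple R) : {ffun 'I_d -> 'I_n.+1} :=
  [ffun j => cell n (tnth x j)].

Lemma measurable_torus_cell n kappa :
  measurable ((torus_cell n : d.-tuple (measurableTypeR R) -> _) @^-1` [set kappa]).
Proof.
rewrite (_ : _ @^-1` _ = \bigcap_(j in [set: 'I_d])
    ((fun x : d.-tuple (measurableTypeR R) => tnth x j) @^-1` ((cell n) @^-1` [set kappa j]))).
  apply: fin_bigcap_measurable => // j _.
  rewrite -[X in measurable X]setTI; apply: measurable_tnth => //.
  have := @measurable_cell R n 1 (kappa j) ltr01.
  by rewrite (_ : (fun t => cell n (t / 1)) = cell n)//; apply/funext => t; rewrite divr1.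
apply/seteqP; split => x /=.
  by move=> <- j _ /=; rewrite ffunE.
by move=> xk; apply/ffunP => j; rewrite ffunE; exact: (xk j I).
Qed.

End torus_cells.

Lemma torus_measure_cell {R : realType} {d : nat} n (kappa : {ffun 'I_d -> 'I_n.+1}) :
  torus_measure d ((torus_cell n : d.-tuple (measurableTypeR R) -> _) @^-1` [set kappa])
  = (n.+1%:R^-1 ^+ d)%:E.
Proof.
elim: d kappa => [|d ih] kappa.
  by rewrite /= diracE mem_set//=; apply/ffunP => -[].
pose kappa' : {ffun 'I_d -> 'I_n.+1} := [ffun j => kappa (lift ord0 j)].
have mc i : measurable (cell n @^-1` [set i] : set (measurableTypeR R)).
  have := @measurable_cell R n 1 i ltr01.
  by rewrite (_ : (fun t => cell n (t / 1)) = cell n)//; apply/funext => t; rewrite divr1.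
have split_cell : @tuple_cons R d @^-1` ((torus_cell n) @^-1` [set kappa]) =
   (cell n @^-1` [set kappa ord0] : set (measurableTypeR R)) `*`
   ((torus_cell n : d.-tuple (measurableTypeR R) -> _) @^-1` [set kappa']).
  apply/seteqP; split => [[x y]|[x y] [/= hx hy]] /=.
    move=> /ffunP xk; split=> /=; first by have := xk ord0; rewrite ffunE tnth0.
    by apply/ffunP => j; have := xk (lift ord0 j); rewrite !ffunE tnthS.
  apply/ffunP => j; rewrite ffunE; have [i ->|->] := unliftP ord0 j; last by rewrite tnth0.
  by rewrite tnthS; move/ffunP : hy => /(_ i); rewrite !ffunE.
rewrite /= /distribution /pushforward split_cell.
rewrite product_measure1E//; last exact: measurable_torus_cell.
transitivity ((n.+1%:R^-1)%:E * (n.+1%:R^-1 ^+ d)%:E : \bar R)%E; last by rewrite -EFinM -exprS.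
congr (_ * _)%E; last exact: ih.
have := lebesgue_measure_cell (kappa ord0) (@ltr01 R); rewrite mul1r => <-.
transitivity (lebesgue_measure
  (`[0%R, 1%R] `&` (cell n @^-1` [set kappa ord0] : set (measurableTypeR R)))).
  by apply: uniform_probE; exact: mc.
by congr (lebesgue_measure (_ `&` _)); apply/seteqP; split => t /=; rewrite divr1.
Qed.

Section torus_riemann.
Context {R : realType} {d : nat} {B : completeNormedModType R[i]}.
Implicit Types (f : 'rV[R]_d -> B) (theta : 'rV[R]_d).

Lemma torus_analytic_diff_lipschitz A f theta (v : 'rV[R]_d) (eps : R) :
  torus_analytic_diff A f ->
  (forall j, `|v 0 j| <= eps) -> eps <= A%:R^-1 ->
  bnorm (f (theta + v) - f theta) <= d%:R * (A%:R ^+ 2 * eps).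
Proof.
move=> [_ fA] veps epsA; rewrite (row_sum_delta v) -[in leRHS](size_enum_ord d) -big_enum/=.
elim: (enum 'I_d) theta => [|j r ih] theta; first by rewrite big_nil addr0 subrr bnorm0 mul0r.
rewrite big_cons addrA /= -natr1 mulrDl mul1r.
rewrite (le_trans (ler_bnorm_dist (f (theta + v 0 j *: delta_mx 0 j)) _ _))// lerD//.
have A20 : 0 <= A%:R ^+ 2 :> R by rewrite exprn_ge0.
have step x (h : R) : 0 <= h -> h <= eps ->
    bnorm (f (x + h *: delta_mx 0 j) - f x) <= A%:R ^+ 2 * eps.
  move=> h0 heps; rewrite (le_trans (analytic_diff_lipschitz _ (fA j) _))//.
    by rewrite h0 (le_trans heps).
  by rewrite ler_wpM2l.
have := veps j; rewrite ler_norml => /andP[v1 v2].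
have [v0|v0] := leP 0 (v 0 j); first exact: step.
have := step (theta + v 0 j *: delta_mx 0 j) (- v 0 j).
rewrite bnormBC -addrA -scalerDl subrr scale0r addr0; apply; first by rewrite oppr_ge0 ltW.
by rewrite lerNl.
Qed.

(** For displacements larger than [1 / A] the bound on [f] itself suffices, at the
    price of the summand [2]. *)
Lemma torus_lipschitz A f theta (v : 'rV[R]_d) (eps : R) :
  (0 < A)%N -> (0 < d)%N -> torus_analytic_diff A f -> 0 <= eps -> (forall j, `|v 0 j| <= eps) ->
  bnorm (f (theta + v) - f theta) <= (d%:R + 2) * A%:R ^+ 2 * eps.
Proof.
move=> A0 d0 fA eps0 veps; have A20 : 0 <= A%:R ^+ 2 * eps by rewrite mulr_ge0 ?exprn_ge0.
rewrite -mulrA mulrDl; have [epsA|epsA] := leP eps A%:R^-1.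
  rewrite (le_trans (torus_analytic_diff_lipschitz _ fA veps epsA))//.
  by rewrite lerDl mulr_ge0.
have [_ fAj] := fA; have fb x := analytic_diff_bounded x (fAj (Ordinal d0)).
rewrite (le_trans (ler_bnormB _ _))// (le_trans (lerD (fb _) (fb _)))//.
have A0' : 0 < A%:R :> R by rewrite ltr0n.
have : 1 <= A%:R * eps by rewrite mulrC -ler_pdivrMr// mul1r ltW.
move=> /(ler_wpM2l (ltW A0')); rewrite mulr1 mulrA => h; rewrite expr2.
by rewrite ler_wpDl ?mulr_ge0//; lra.
Qed.

Definition grid_point n (kappa : {ffun 'I_d -> 'I_n.+1}) : 'rV[R]_d :=
  \row_j ((kappa j)%:R / n.+1%:R).

Definition grid_average n f : B :=
  ((n.+1%:R^-1) ^+ d)%:C *: \sum_kappa f (@grid_point n kappa).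

(** The sum of a character over the grid is a product of sums of roots of unity; if
    the frequency is not zero, one of them vanishes because the entries are smaller
    than the grid size. *)
Lemma grid_average_trig n (s : seq ('rV[int]_d * B)) :
  (forall p l, p \in s -> `|p.1 0 l| <= n%:Z) ->
  grid_average n (trig_poly s) = \sum_(p <- s | p.1 == 0) p.2.
Proof.
move=> sn; rewrite /grid_average /trig_poly exchange_big/= scaler_sumr.
rewrite [RHS]big_mkcond/= [LHS]big_seq [RHS]big_seq; apply: eq_bigr => p ps.
rewrite -scaler_suml scalerA.
have -> : \sum_kappa expi (dot p.1 (@grid_point n kappa)) =
   \prod_(j < d) \sum_(i < n.+1) expi (i%:R * ((p.1 0 j)%:~R / n.+1%:R)) :> R[i].
  rewrite bigA_distr_bigA /=; apply: eq_bigr => kappa _; rewrite expi_sum.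
  by apply: eq_bigr => j _; rewrite mxE mulrCA.
case: eqVneq => [->|/eqP p0].
  under eq_bigr do under eq_bigr do rewrite mxE mul0r mulr0 expi0.
  under eq_bigr do rewrite sumr_const card_ord.
  rewrite prodr_const card_ord rmorphXn -exprMn.
  have -> : (n.+1%:R^-1)%:C * n.+1%:R = 1 :> R[i].
    by rewrite mulr_natr -rmorphMn/= -[_ *+ n.+1]mulr_natr mulVf.
  by rewrite expr1n scale1r.
have [j pj] : exists j, p.1 0 j != 0.
  apply/existsP; apply: contra_notT p0; rewrite negb_exists => /forallP h.
  by apply/rowP => j; rewrite mxE; have /negPn/eqP := h j.
rewrite (bigD1 j)//= -(big_mkord xpredT (fun i => expi (i%:R * ((p.1 0 j)%:~R / n.+1%:R)))).
rewrite sum_expi_root ?mul0r ?mulr0 ?scale0r//.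
have := sn p j ps; rewrite -[p.1 0 j]/(p.1 0 j) => pn.
by rewrite gtnNdvd ?absz_gt0//; lia.
Qed.

Lemma cvg_grid_average A f : (0 < A)%N -> (0 < d)%N -> torus_analytic_diff A f ->
  (fun n => grid_average n f) @ \oo --> torus_integral f.
Proof.
move=> A0 d0 fA.
pose eps n : R := (d%:R + 2) * A%:R ^+ 2 * n.+1%:R^-1.
have := @cvg_riemann_bochner R B _ _ (torus_measure d) setT measurableT _
  (fun n => {ffun 'I_d -> 'I_n.+1}) (fun n => torus_cell n)
  (fun n kappa => f (grid_point kappa)) (fun x => f (point_of_tuple x)) eps.
have -> : (fun n => \sum_kappa (fine (torus_measure d (setT `&`
        (torus_cell n : d.-tuple (measurableTypeR R) -> _) @^-1` [set kappa])))%:C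
      *: f (grid_point kappa)) = (fun n => grid_average n f).
  apply/funext => n; rewrite /grid_average scaler_sumr; apply: eq_bigr => kappa _.
  by rewrite setTI torus_measure_cell.
apply.
- by apply: le_lt_trans (ltry 1); exact: probability_le1.
- by move=> n kappa; exact: measurable_torus_cell.
- move=> n x _.
  have cj j := (@cellP R n (tnth x j) (cell n (tnth x j))).1 erefl.
  have [z hz] := choice cj.
  pose u : 'rV[R]_d := grid_point (torus_cell n x).
  pose v : 'rV[R]_d := \row_j (tnth x j - ((z j)%:~R + (cell n (tnth x j))%:R / n.+1%:R)).
  have -> : point_of_tuple x = (u + v) + lattice (\row_j z j).
    by apply/rowP => j; rewrite !mxE ffunE; ring.
  have [fp _] := fA; rewrite fp.
  apply: torus_lipschitz; rewrite ?invr_ge0// => j.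
  have /andP[h1 h2] := hz j; rewrite mxE ger0_norm ?subr_ge0//.
  by move: h2; rewrite -natr1 mulrDl mul1r addrA addrC -ltrBlDr => /ltW.
- rewrite /eps; have -> : 0 = (d%:R + 2) * A%:R ^+ 2 * 0 :> R by rewrite mulr0.
  by apply: cvgMr; exact: cvg_harmonic.
Qed.

(** Averages over fine grids converge to the integral of [f], and are exact on
    [trig_poly s], where they select the constant term. *)
Lemma torus_integral_trig_approx A f K (s : seq ('rV[int]_d * B)) (e : R) :
  (0 < A)%N -> (0 < d)%N -> torus_analytic_diff A f ->
  (forall p l, p \in s -> `|p.1 0 l| <= K%:Z) ->
  (forall theta, bnorm (f theta - trig_poly s theta) <= e) ->
  bnorm (torus_integral f - \sum_(p <- s | p.1 == 0) p.2) <= e.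
Proof.
move=> A0 d0 fA sK fs; have fcvg := cvg_grid_average A0 d0 fA.
apply: (cvg_bnorm_le (cvgB fcvg (cvg_cst (\sum_(p <- s | p.1 == 0) p.2)))).
near=> n; rewrite [X in bnorm X](_ : _ = grid_average n f - \sum_(p <- s | p.1 == 0) p.2)//.
have Kn : (K <= n)%N by near: n; exact: nbhs_infty_ge.
rewrite -[X in _ - X](@grid_average_trig n); last first.
  by move=> p l ps; rewrite (le_trans (sK p l ps))// lez_nat.
rewrite /grid_average -scalerBr -sumrB bnormZr ger0_norm ?exprn_ge0 ?invr_ge0//.
rewrite exprVn mulrC ler_pdivrMr ?exprn_gt0 ?ltr0n//.
rewrite (le_trans (ler_bnorm_sum _ _ _))//.
rewrite (le_trans (ler_sum _ (fun kappa _ => fs _)))// sumr_const.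
by rewrite card_ffun !card_ord -[leLHS]mulr_natr natrX.
Unshelve. all: by end_near. Qed.

End torus_riemann.

(** * Normalization of the weight *)

Section weight_riemann.
Context {R : realType}.
Local Notation mu := (@lebesgue_measure R).
Local Notation Z := (\int[lebesgue_measure]_(s in `[0, 1]) bump s : R).

(** [162 = 2 * 3 ^ 4] is the bound of [fdiffn_window_le] for [m = 1]. *)
Lemma window_lipschitz (x h : R) : 0 <= h -> `|window (x + h) - window x| <= 162 * h.
Proof.
move=> h0; apply: le_trans (fdiffn_window_le 1 x h0) _.
by rewrite !expr1 mulrC ler_wpM2r// -natrM ler_nat.
Qed.

Lemma measurable_window (D : set R) : measurable D -> measurable_fun D (@window R).
Proof.
move=> mD; apply: measurable_funTS; apply: continuous_measurable_fun => x.
apply: continuousM.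
  apply/differentiable_continuous/derivable1_diffP.
  by case: (is_derive_expinv 0 x).
apply: (@continuous_comp _ _ _ (fun y : R => 1 - y) (expinv_derive 0)).
  by apply: continuousB; [exact: cvg_cst|exact: cvg_id].
apply/differentiable_continuous/derivable1_diffP.
by case: (is_derive_expinv 0 (1 - x)).
Qed.

Lemma window_cell_le n (x : R) : 0 <= x <= 1 ->
  `|window x - window ((cell n (x / 1))%:R / n.+1%:R)| <= 162 / n.+1%:R.
Proof.
move=> /andP[x0]; rewrite le_eqVlt => /orP[/eqP ->|x1].
  rewrite window_eq0 ?ltxx ?andbF// sub0r normrN.
  have /cellP : cell n ((1 : R) / 1) = ord0.
    apply/cellP; exists 1; rewrite divr1 mul0r addr0 lexx ltrDl divr_gt0//.
  move=> /cellP ->; rewrite mul0r window_eq0 ?ltxx// normr0 divr_ge0//.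
have := @cell_lt R n 1 x ltr01 x0 x1; set i := cell _ _; rewrite !mul1r => /andP[h1 h2].
have {1}-> : x = i%:R / n.+1%:R + (x - i%:R / n.+1%:R) by rewrite addrC subrK.
rewrite (le_trans (window_lipschitz _ _)) ?subr_ge0// ler_wpM2l//.
by move: h2; rewrite -natr1 mulrDl mul1r addrC -ltrBlDr => /ltW.
Qed.

(** The integrands differ at the end points, where [bump] is [1]. *)
Lemma integral_bump_window :
  (\int[mu]_(x in `[0%R, 1%R]) (bump x)%:E = \int[mu]_(x in `[0%R, 1%R]) (window x)%:E)%E.
Proof.
have wb : {in `]0%R, 1%R[%classic, (fun x : R => (window x)%:E) =1 (fun x => (bump x)%:E)}.
  by move=> x /set_mem/=; rewrite in_itv/= => /window_bump ->.
have mw : measurable_fun (`]0%R, 1%R[%classic : set R) (fun x : R => (window x)%:E).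
  by apply/measurable_EFinP; exact: measurable_window.
have mb : measurable_fun (`]0%R, 1%R[%classic : set R) (fun x : R => (bump x)%:E).
  exact: eq_measurable_fun wb mw.
rewrite (integral_itv_bndoo true false mb) (integral_itv_bndoo true false mw).
by apply: eq_integral => x /wb ->.
Qed.

Definition riemann_window n : R := n.+1%:R^-1 * \sum_(i < n.+1) window (i%:R / n.+1%:R).

Lemma integral_window_riemann n :
  (\int[mu]_(x in `[0%R, 1%R]) (window x)%:E <= (riemann_window n + 162 / n.+1%:R)%:E)%E /\
  ((riemann_window n)%:E <= \int[mu]_(x in `[0%R, 1%R]) (window x)%:E + (162 / n.+1%:R)%:E)%E.
Proof.
have m01 : measurable (`[0%R, 1%R]%classic : set R) by exact: measurable_itv.
pose l (x : measurableTypeR R) := cell n ((x : R) / 1); have ml i : measurable (l @^-1` [set i]).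
  exact: measurable_cell.
have muE i : mu (`[0%R, 1%R] `&` l @^-1` [set i]) = (1 / n.+1%:R)%:E.
  by apply: lebesgue_measure_cell.
have e0 : 0 <= 162 / n.+1%:R :> R by rewrite divr_ge0// ler0n.
have N0 : n.+1%:R != 0 :> R by [].
have sumE (c : R) : 0 <= c ->
    (\int[mu]_(x in `[0%R, 1%R]) ((fun i : 'I_n.+1 => window (i%:R / n.+1%:R) + c) (l x))%:E
     = (riemann_window n + c)%:E)%E.
  move=> c0; rewrite (ge0_integral_fibres ml mu
    (phi := fun i : 'I_n.+1 => window (i%:R / n.+1%:R) + c))//; last first.
    by move=> i; rewrite addr_ge0// window_ge0.
  rewrite (eq_bigr (fun i : 'I_n.+1 =>
    ((window (i%:R / n.+1%:R) + c) * (1 / n.+1%:R))%:E)); last first.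
    by move=> i _; rewrite EFinM; congr (_ * _)%E; exact: muE.
  rewrite sumEFin; congr EFin; rewrite -mulr_suml mul1r big_split/= mulrDl mulrC.
  congr (_ + _); rewrite sumr_const card_ord -[_ *+ n.+1]mulr_natr.
  by rewrite mulfK.
have mw : measurable_fun (`[0%R, 1%R]%classic : set R) (fun x : R => (window x)%:E).
  by apply/measurable_EFinP; exact: measurable_window.
have ml' (c : R) : measurable_fun (`[0%R, 1%R]%classic : set R)
    (fun x => ((fun i : 'I_n.+1 => window (i%:R / n.+1%:R) + c) (l x))%:E).
  apply/measurable_EFinP.
  exact: (measurable_fun_fibres ml (fun i : 'I_n.+1 => window (i%:R / n.+1%:R) + c) m01).
split.
  rewrite -sumE//; apply: ge0_le_integral => //.
  - by move=> x _; rewrite lee_fin window_ge0.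
  - exact: ml'.
  - move=> x /=; rewrite in_itv/= => /(window_cell_le n); rewrite lee_fin ler_norml => /andP[_].
    by rewrite lerBlDl.
have -> : ((162 / n.+1%:R)%:E = \int[mu]_(x in `[0%R, 1%R]) (162 / n.+1%:R)%:E :> \bar R)%E.
  rewrite integral_cst//= lebesgue_measure_itv/= lte_fin ltr01 -EFinB subr0 mule1//.
rewrite -ge0_integralD//; last by move=> x _; rewrite lee_fin window_ge0.
rewrite -[riemann_window n]addr0 -sumE//; apply: ge0_le_integral => //.
- by move=> x _; rewrite lee_fin addr0 window_ge0.
- exact: ml'.
- by apply: emeasurable_funD.
- move=> x /=; rewrite in_itv/= => /(window_cell_le n).
  rewrite -EFinD lee_fin ler_norml => /andP[h _].
  by rewrite addr0 -lerBlDr addrC -lerBrDr.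
Qed.

Lemma integral_bump_riemann n : `|Z - riemann_window n| <= 162 / n.+1%:R.
Proof.
rewrite /Rintegral integral_bump_window; have [h1 h2] := integral_window_riemann n.
have I0 : (0 <= \int[mu]_(x in `[0%R, 1%R]) (window x)%:E)%E.
  by apply: integral_ge0 => x _; rewrite lee_fin window_ge0.
have If : (\int[mu]_(x in `[0%R, 1%R]) (window x)%:E)%E \is a fin_num.
  by rewrite ge0_fin_numE// (le_lt_trans h1)// ltry.
move: h1 h2; rewrite -(fineK If) -EFinD !lee_fin => h1 h2.
by rewrite ler_distl h1 andbT lerBlDr.
Qed.

Lemma integral_bump_gt0 : 0 < Z.
Proof.
rewrite /Rintegral integral_bump_window.
have m01 : measurable (`[0%R, 1%R]%classic : set R) by exact: measurable_itv.
have [h1 _] := integral_window_riemann 0.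
have mw (D : set R) : measurable D -> measurable_fun D (fun x : R => (window x)%:E).
  by move=> mD; apply/measurable_EFinP; exact: measurable_window.
apply: fine_gt0; rewrite (le_lt_trans h1) ?ltry// andbT.
(* on [[1/4, 1/2]] the product [x (1 - x)] is at least [1/8] *)
apply: (@lt_le_trans _ _ (\int[mu]_(x in `[4^-1%R, 2^-1%R]) (expR (- 8))%:E)%E).
  rewrite integral_cst//= lebesgue_measure_itv/= lte_fin.
  have -> : 4^-1 < 2^-1 :> R by lra.
  by rewrite -EFinB -EFinM lte_fin mulr_gt0 ?expR_gt0//; lra.
apply: (@le_trans _ _ (\int[mu]_(x in `[4^-1%R, 2^-1%R]) (window x)%:E)%E); last first.
  apply: ge0_subset_integral => //; first exact: mw.
  - by move=> x _; rewrite lee_fin window_ge0.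
  - by move=> x /=; rewrite !in_itv/= => /andP[? ?]; apply/andP; split; lra.
apply: ge0_le_integral => //.
- by apply: mw; exact: measurable_itv.
- move=> x /=; rewrite in_itv/= => /andP[x4 x2].
  have x0 : 0 < x by lra.
  have x1 : 0 < 1 - x by lra.
  rewrite window_bump ?x0/=; last by lra.
  rewrite lee_fin ler_expR lerN2 -invfM invf_ple ?posrE ?mulr_gt0//.
  by nra.
Qed.

Definition mean_weight n : R := n.+1%:R^-1 * \sum_(i < n.+1) weight (i%:R / n.+1%:R).

Lemma mean_weightE n : mean_weight n = Z^-1 * riemann_window n.
Proof.
by rewrite /mean_weight; under eq_bigr do rewrite weightE; rewrite -mulr_sumr mulrCA.
Qed.

(** The weight is normalized by its integral, the means are Riemann sums. *)
Lemma cvg_mean_weight : mean_weight @ \oo --> (1 : R).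
Proof.
have Z0 := integral_bump_gt0.
have -> : mean_weight = (fun n => Z^-1 * riemann_window n).
  by apply/funext => n; exact: mean_weightE.
rewrite -[X in _ --> X](mulVf (_ : Z != 0)) ?gt_eqF//; apply: cvgMr.
apply/cvgrPdist_le => e e0; near=> n; rewrite (le_trans (integral_bump_riemann n))//.
rewrite ler_pdivrMr// mulrC -ler_pdivrMr//.
apply: (@le_trans _ _ n%:R); last by rewrite ler_nat.
by near: n; exact: nbhs_infty_ger.
Unshelve. all: by end_near. Qed.

End weight_riemann.

(** * Weighted averages of analytic functions *)

Section weight_bounds.
Context {R : realType}.
Local Notation Z := (\int[lebesgue_measure]_(s in `[0, 1]) bump s : R).

Lemma weight_ge0 (x : R) : 0 <= weight x.
Proof. by rewrite weightE mulr_ge0 ?window_ge0// invr_ge0 ltW// integral_bump_gt0. Qed.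

Lemma weight_le (x : R) : weight x <= Z^-1.
Proof.
have Z0 := @integral_bump_gt0 R.
have := fdiffn_weight_le 0 x (lexx 0).
by rewrite !expr0 !mul1r mulr1 /= !ger0_norm ?weight_ge0// invr_ge0 ltW.
Qed.

Lemma weight_lipschitz (x h : R) : 0 <= h -> `|weight (x + h) - weight x| <= Z^-1 * (162 * h).
Proof.
move=> h0; have Z0 := @integral_bump_gt0 R.
rewrite !weightE -mulrBr normrM ger0_norm ?invr_ge0 ?(ltW Z0)//.
by rewrite ler_wpM2l ?invr_ge0 ?(ltW Z0)// window_lipschitz.
Qed.

Lemma mean_weight_ge0 n : 0 <= mean_weight n :> R.
Proof.
by rewrite mulr_ge0 ?invr_ge0//; apply: sumr_ge0 => i _; exact: weight_ge0.
Qed.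

End weight_bounds.

Section orbit_average.
Context {R : realType} {d : nat} {B : completeNormedModType R[i]}.
Implicit Types (f : 'rV[R]_d -> B) (theta rho : 'rV[R]_d).

(** Not divided by the mean of the weights, so that it is also a Riemann sum of the
    continuous average. *)
Definition orbit_mean n rho f theta : B :=
  (n.+1%:R^-1)%:C *: \sum_(i < n.+1) (weight (i%:R / n.+1%:R))%:C *: f (theta + i%:R *: rho).

Lemma orbit_mean_le n rho f theta (e : R) : (forall th, bnorm (f th) <= e) ->
  bnorm (orbit_mean n rho f theta) <= mean_weight n * e.
Proof.
move=> fe; rewrite /orbit_mean bnormZr ger0_norm ?invr_ge0// /mean_weight -mulrA.
rewrite ler_wpM2l ?invr_ge0// (le_trans (ler_bnorm_sum _ _ _))// mulr_suml.
by apply: ler_sum => i _; rewrite bnormZr ger0_norm ?weight_ge0// ler_wpM2l ?weight_ge0.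
Qed.

Lemma orbit_mean_trig n rho (s : seq ('rV[int]_d * B)) theta :
  orbit_mean n rho (trig_poly s) theta = \sum_(p <- s)
    (((n.+1%:R^-1)%:C * weighted_sum n.+1 (dot p.1 rho)) * expi (dot p.1 theta)) *: p.2.
Proof.
rewrite /orbit_mean /trig_poly; under eq_bigr do rewrite scaler_sumr.
rewrite exchange_big/= scaler_sumr; apply: eq_bigr => p _.
rewrite /weighted_sum big_mkord -mulrA -scalerA; congr (_ *: _).
rewrite mulr_suml scaler_suml; apply: eq_bigr => i _.
by rewrite scalerA dotDr dotZr expiD; congr (_ *: _); ring.
Qed.

(** Common to both cases, [rho] being either the rotation vector or a fraction of
    it: the terms are the error of the trigonometric approximation of degree [K]
    and the exponential sums of its nonconstant part. *)
Lemma orbit_mean_approx A : (0 < A)%N -> (0 < d)%N ->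
  exists2 C : R, 0 < C & exists2 c : R, 0 < c & forall K f n rho theta (delta : R),
    torus_analytic_diff A f -> 0 < delta ->
    (forall k : 'rV[int]_d, k != 0 -> (forall j, `|k 0 j| <= K%:Z) ->
      forall m : int, delta <= `|dot k rho - m%:~R|) ->
    bnorm (orbit_mean n rho f theta - (mean_weight n)%:C *: torus_integral f) <=
    C * (2 * K).+1%:R ^+ d * (mean_weight n * expR (- c * K%:R)
       + expR (- c * (n.+1%:R * delta) `^ 4^-1)).
Proof.
move=> A0 d0; have [C1 C10 [c1 c10 approx]] := @trig_approx R d B A A0 d0.
have [C2 C20 [c2 c20 expsum]] := @weighted_sum_le R.
pose c := Num.min c1 c2; have c0 : 0 < c by rewrite lt_min c10.
exists (2 * C1 + A%:R * C2); first by rewrite addr_gt0// !mulr_gt0// ltr0n.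
exists c => // K f n rho theta delta fA delta0 dioph.
have [s [sK sA sf]] := approx K f fA.
set Q := (2 * K).+1%:R ^+ d in sA sf *; have Q0 : 0 <= Q by rewrite exprn_ge0.
set e := Q * (C1 * _) in sf; pose W : R := mean_weight n.
have W0 : 0 <= W by exact: mean_weight_ge0.
pose c00 := \sum_(p <- s | p.1 == 0) p.2.
have h1 : bnorm (orbit_mean n rho f theta - orbit_mean n rho (trig_poly s) theta) <= W * e.
  have -> : orbit_mean n rho f theta - orbit_mean n rho (trig_poly s) theta =
      orbit_mean n rho (fun th => f th - trig_poly s th) theta.
    rewrite /orbit_mean -scalerBr -sumrB; congr (_ *: _).
    by apply: eq_bigr => i _; rewrite scalerBr.
  exact: orbit_mean_le.
have h3 : bnorm (W%:C *: c00 - W%:C *: torus_integral f) <= W * e.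
  rewrite -scalerBr bnormZr ger0_norm// ler_wpM2l// bnormBC.
  exact: torus_integral_trig_approx A0 d0 fA sK sf.
set E := expR (- c * (n.+1%:R * delta) `^ 4^-1).
have h2 : bnorm (orbit_mean n rho (trig_poly s) theta - W%:C *: c00) <= A%:R * Q * (C2 * E).
  have -> : W%:C *: c00 = \sum_(p <- s | p.1 == 0)
     (((n.+1%:R^-1)%:C * weighted_sum n.+1 (dot p.1 rho)) * expi (dot p.1 theta)) *: p.2.
    rewrite scaler_sumr; apply: eq_bigr => p /eqP ->; rewrite !dot0 expi0 mulr1.
    congr (_ *: _); rewrite /W /mean_weight /weighted_sum big_mkord rmorphM rmorph_sum /=.
    by congr (_ * _); apply: eq_bigr => i _; rewrite mulr0 expi0 mul1r.
  rewrite orbit_mean_trig (bigID (fun p => p.1 == 0))/= addrAC subrr add0r.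
  rewrite (le_trans (ler_bnorm_sum _ _ _))//.
  have CE : 0 <= C2 * E by rewrite mulr_ge0 ?expR_ge0// ltW.
  apply: (@le_trans _ _ (\sum_(p <- s) C2 * E * bnorm p.2)); last first.
    by rewrite -mulr_sumr mulrC ler_wpM2r.
  rewrite big_seq_cond [leRHS]big_seq [leRHS](bigID (fun p => p.1 == 0))/=.
  rewrite ler_wpDl//; first by apply: sumr_ge0 => p _; rewrite mulr_ge0 ?bnorm_ge0.
  apply: ler_sum => p /andP[ps p0].
  rewrite bnormZ ler_wpM2r ?bnorm_ge0// !normcM normc_expi mulr1 normc_real.
  rewrite ger0_norm ?invr_ge0// mulrC ler_pdivrMr ?ltr0n// mulrC.
  have := expsum n.+1 (dot p.1 rho) delta isT delta0 (dioph _ p0 (fun j => sK p j ps)).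
  move=> /le_trans; apply; rewrite ler_wpM2l// ler_wpM2l ?(ltW C20)// ler_expR.
  by rewrite ler_wpM2r ?powR_ge0// lerN2 ge_min lexx orbT.
have eE : e <= Q * (C1 * expR (- c * K%:R)).
  rewrite /e ler_wpM2l// ler_wpM2l ?(ltW C10)// ler_expR ler_wpM2r// lerN2.
  by rewrite ge_min lexx.
rewrite (le_trans (ler_bnorm_dist (orbit_mean n rho (trig_poly s) theta) _ _))//.
rewrite (le_trans (lerD h1 (ler_bnorm_dist (W%:C *: c00) _ _)))//.
rewrite (le_trans (lerD (lexx _) (lerD h2 h3)))//.
have h4 := ler_wpM2l W0 eE.
rewrite (le_trans (lerD h4 (lerD (lexx _) h4)))//.
set X := expR (- c * K%:R); have X0 : 0 <= X by exact: expR_ge0.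
have E0 : 0 <= E by exact: expR_ge0.
rewrite -subr_ge0 (_ : _ - _ = 2 * C1 * (Q * E) + A%:R * C2 * (Q * (W * X))); last first.
  by rewrite -/W; ring.
have C1p := ltW C10; have C2p := ltW C20.
by apply: addr_ge0; apply: mulr_ge0 (mulr_ge0 _ _) (mulr_ge0 _ _) => //; exact: mulr_ge0.
Qed.

End orbit_average.

(** * Choice of the truncation degree *)

Section rates.
Context {R : realType}.

Lemma exp_absorb_poly (d : nat) (eta x : R) : 0 < eta -> 0 <= x ->
  x ^+ d <= d`!%:R * eta ^- d * expR (eta * x).
Proof.
move=> eta0 x0; have := exprn_expRN_le d (mulr_ge0 (ltW eta0) x0).
rewrite expRN ler_pdivrMr ?expR_gt0// exprMn => h.
by rewrite mulrAC ler_pdivlMr ?exprn_gt0// mulrC.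
Qed.

(** With [K] about [T ^ xi] and [delta] about [K ^ (- tau)], the equation
    [1 - tau xi = 4 xi] makes both exponents comparable with [T ^ xi]. *)
Lemma truncation_rate (d : nat) (tau alpha c : R) :
  (0 < d)%N -> 0 < tau -> 0 < alpha -> 0 < c ->
  let xi := 4^-1 * (1 + tau * 4^-1)^-1 in
  exists2 C : R, 0 < C & exists2 c' : R, 0 < c' & forall T : R, 1 <= T ->
    exists2 K : nat, (0 < K)%N &
      (2 * K).+1%:R ^+ d * (expR (- c * K%:R) +
        expR (- c * (T * (alpha / (d%:R * K%:R) `^ tau)) `^ 4^-1)) <= C * expR (- c' * T `^ xi).
Proof.
move=> d0 tau0 alpha0 c0 xi.
have q0 : 0 < 1 + tau * 4^-1 :> R by rewrite ltr_wpDl// ?mulr_gt0// addr_gt0// mulr_gt0.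
have xi0 : 0 < xi by rewrite mulr_gt0// invr_gt0.
have xiE : 1 - tau * xi = xi * 4 by rewrite /xi; field; rewrite gt_eqF//; lra.
pose a := alpha / d%:R `^ tau.
have dR0 : 0 < d%:R :> R by rewrite ltr0n.
have a0 : 0 < a by rewrite divr_gt0// powR_gt0.
pose b := a `^ 4^-1; have b0 : 0 < b by rewrite powR_gt0.
pose c1 := Num.min c (c * b); have c10 : 0 < c1 by rewrite lt_min c0 mulr_gt0.
(* half of the decay rate absorbs the polynomial factor *)
pose eta := c1 / 2; have eta0 : 0 < eta by rewrite divr_gt0.
pose C := 3 ^+ d * (d`!%:R * eta ^- d) * (expR c + 1).
exists C.
  by rewrite !mulr_gt0 ?exprn_gt0 ?invr_gt0 ?exprn_gt0 ?ltr0n ?fact_gt0// addr_gt0// expR_gt0.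
exists eta => // T T1; pose x := T `^ xi.
have T0 : 0 < T by rewrite (lt_le_trans ltr01).
have x1 : 1 <= x by rewrite -(powRr0 T) ler_powR// ltW.
have x0 : 0 < x by rewrite (lt_le_trans ltr01).
pose K := Num.truncn x; have /andP[K1 K2] : K%:R <= x < K.+1%:R by rewrite truncn_itv// ltW.
have K0 : (0 < K)%N by rewrite -(ltr_nat R) -(ltrD2r 1) add0r natr1 (le_lt_trans x1).
have KR0 : 0 < K%:R :> R by rewrite ltr0n.
exists K => //.
have e1 : expR (- c * K%:R) <= expR c * expR (- c1 * x).
  rewrite -expRD ler_expR; have c1c : c1 <= c by rewrite ge_min lexx.
  rewrite -natr1 in K2; nra.
have e2 : expR (- c * (T * (alpha / (d%:R * K%:R) `^ tau)) `^ 4^-1) <= expR (- c1 * x).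
  rewrite ler_expR !mulNr lerN2.
  have Xge : a * x ^+ 4 <= T * (alpha / (d%:R * K%:R) `^ tau).
    have xK : (d%:R * K%:R) `^ tau <= d%:R `^ tau * T `^ (tau * xi).
      rewrite powRM ?(ltW dR0) ?(ltW KR0)// ler_wpM2l ?powR_ge0// mulrC powRrM.
      by rewrite ge0_ler_powR ?nnegrE ?powR_ge0 ?(ltW tau0) ?(ltW KR0).
    have xp : x ^+ 4 = T `^ (1 - tau * xi).
      by rewrite xiE powRrM powR_mulrn// powR_ge0.
    have TE : T `^ (1 - tau * xi) * T `^ (tau * xi) = T.
      by rewrite -powRD ?subrK ?powRr1 ?(ltW T0)// (gt_eqF T0) implybT.
    have dK0 : 0 < (d%:R * K%:R) `^ tau by rewrite powR_gt0// mulr_gt0.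
    rewrite mulrA ler_pdivlMr// xp.
    apply: (le_trans (ler_wpM2l _ xK)); first by rewrite mulr_ge0 ?powR_ge0// ltW.
    rewrite /a -[in leRHS]TE; apply: eqW; field.
    by rewrite gt_eqF// powR_gt0.
  have h : b * x <= (T * (alpha / (d%:R * K%:R) `^ tau)) `^ 4^-1.
    have -> : b * x = (a * x ^+ 4) `^ 4^-1.
      rewrite powRM ?(ltW a0) ?exprn_ge0 ?(ltW x0)//; congr (_ * _).
      by rewrite -powR_mulrn ?(ltW x0)// -powRrM mulfV// powRr1// ltW.
    rewrite ge0_ler_powR ?nnegrE ?invr_ge0//.
      by rewrite mulr_ge0 ?exprn_ge0 ?(ltW a0) ?(ltW x0).
    by rewrite mulr_ge0 ?divr_ge0 ?powR_ge0 ?(ltW T0) ?(ltW alpha0).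
  have c1b : c1 <= c * b by rewrite ge_min lexx orbT.
  apply: (@le_trans _ _ (c * b * x)); first by rewrite ler_wpM2r// ltW.
  by rewrite -mulrA ler_wpM2l// ltW.
have pK : (2 * K).+1%:R ^+ d <= 3 ^+ d * (d`!%:R * eta ^- d * expR (eta * x)) :> R.
  apply: (@le_trans _ _ ((3 * x) ^+ d)).
    rewrite lerXn2r ?nnegrE ?mulr_ge0 ?(ltW x0)//.
    rewrite (le_trans (_ : _ <= 3 * K%:R)) ?ler_wpM2l//.
    by rewrite -natrM ler_nat; move: (K) K0 => k k0; clear -k0; lia.
  by rewrite exprMn ler_wpM2l ?exprn_ge0// exp_absorb_poly// ltW.
have sumE : expR (- c * K%:R) + expR (- c * (T * (alpha / (d%:R * K%:R) `^ tau)) `^ 4^-1)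
    <= (expR c + 1) * expR (- c1 * x) by rewrite mulrDl mul1r lerD.
apply: (le_trans (ler_pM _ _ pK sumE)); rewrite ?exprn_ge0 ?addr_ge0 ?expR_ge0//.
have -> : expR (- eta * T `^ xi) = expR (eta * x) * expR (- c1 * x).
  by rewrite -expRD -/x; congr expR; rewrite /eta; field.
by apply: eqW; rewrite /C; ring.
Qed.

End rates.

Section diophantine_box.
Context {R : realType} {d : nat}.

Lemma norm1_box_le (k : 'rV[int]_d) K : (forall j, `|k 0 j| <= K%:Z) ->
  norm1 k <= d%:R * K%:R :> R.
Proof.
move=> kK; rewrite /norm1 -[d in leRHS]card_ord mulr_natl -sumr_const.
by apply: ler_sum => j _; rewrite pmulrn ler_int.
Qed.

Lemma norm1_gt0 (k : 'rV[int]_d) : k != 0 -> 0 < norm1 k :> R.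
Proof.
move=> k0; have [j kj] : exists j, k 0 j != 0.
  apply/existsP; apply: contraNT k0; rewrite negb_exists => /forallP h.
  by apply/eqP/rowP => j; rewrite mxE; have /negPn/eqP := h j.
rewrite /norm1 (bigD1 j)//=; apply: ltr_wpDr; last by rewrite ltr0z normr_gt0.
by apply: sumr_ge0 => i _; rewrite ler0z.
Qed.

Lemma small_divisor_box (alpha tau : R) (k : 'rV[int]_d) K : 0 < alpha -> 0 < tau ->
  k != 0 -> (forall j, `|k 0 j| <= K%:Z) ->
  alpha / (d%:R * K%:R) `^ tau <= alpha / norm1 k `^ tau.
Proof.
move=> alpha0 tau0 k0 kK; have n0 := norm1_gt0 k0; have nK := norm1_box_le kK.
rewrite ler_wpM2l ?(ltW alpha0)// lef_pV2 ?posrE ?powR_gt0 ?(lt_le_trans n0)//.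
by rewrite ge0_ler_powR ?nnegrE ?(ltW tau0) ?(ltW n0)// (le_trans (ltW n0)).
Qed.

End diophantine_box.

(** * The two averages *)

Section averages.
Context {R : realType} {d : nat} {B : completeNormedModType R[i]}.
Implicit Types (f : 'rV[R]_d -> B) (theta rho : 'rV[R]_d).

Lemma iter_rotation rho theta n :
  exists m, iter n (rotation rho) theta = theta + n%:R *: rho + lattice m.
Proof.
elim: n => [|n [m ih]].
  by exists 0; apply/rowP => j; rewrite !mxE mul0r !addr0.
exists (m - \row_j Num.floor (iter n (rotation rho) theta 0 j + rho 0 j)).
apply/rowP => j; rewrite iterS !mxE rmorphB/= -natr1.
by rewrite {1}ih !mxE; ring.
Qed.

Lemma weighted_birkhoff_discreteE rho f theta n : torus_periodic f ->
  weighted_birkhoff_discrete n.+1 rho f theta =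
  ((mean_weight n)^-1)%:C *: orbit_mean n rho f theta.
Proof.
move=> fp; rewrite /weighted_birkhoff_discrete /orbit_mean /mean_weight !big_mkord.
rewrite scalerA -rmorphM/= invfM invrK mulrAC mulfV// mul1r; congr (_ *: _).
apply: eq_bigr => i _; congr (_ *: _).
by have [m ->] := iter_rotation rho theta i; rewrite fp.
Qed.

(** The time average is the limit of its Riemann sums, which are discrete
    averages for the translation by [(T / n) rho]. *)
Lemma cvg_orbit_mean_continuous A f rho theta (T : R) :
  (0 < A)%N -> (0 < d)%N -> torus_analytic_diff A f -> 0 < T ->
  (fun n => orbit_mean n ((T / n.+1%:R) *: rho) f theta) @ \oo -->
    weighted_birkhoff_continuous T rho f theta.
Proof.
move=> A0 d0 fA T0.
pose g (t : R) := (weight (t / T))%:C *: f (t *: rho + theta).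
pose r := \sum_j `|rho 0 j|; have r0 : 0 <= r by apply: sumr_ge0.
have rj j : `|rho 0 j| <= r.
  by rewrite /r (bigD1 j)//= lerDl sumr_ge0.
pose Z : R := (\int[lebesgue_measure]_(s in `[0, 1]) bump s)^-1.
have Z0 : 0 <= Z by rewrite invr_ge0 ltW// integral_bump_gt0.
pose L : R := Z * 162 * A%:R + Z * ((d%:R + 2) * A%:R ^+ 2 * (T * r)).
pose eps n : R := L * n.+1%:R^-1.
have fb x : bnorm (f x) <= A%:R.
  by have [_ fj] := fA; exact: analytic_diff_bounded (fj (Ordinal d0)).
pose l n (t : measurableTypeR R) := cell n ((t : R) / T).
pose phi n (i : 'I_n.+1) := g (T * (i%:R / n.+1%:R)).
have near_grid n (t : R) : 0 <= t -> t < T ->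
    bnorm (g t - g (T * ((cell n (t / T))%:R / n.+1%:R))) <= eps n.
  move=> t0 tT; have /andP[h1 h2] := cell_lt n T0 t0 tT.
  set t' := T * _ in h1 *; pose h := t - t'.
  have h0 : 0 <= h by rewrite subr_ge0.
  have hN : h <= T / n.+1%:R.
    rewrite lerBlDl ltW// (lt_le_trans h2)// /t' -natr1 mulrDl mul1r mulrDr.
    by [].
  have hT : h / T <= n.+1%:R^-1 by rewrite ler_pdivrMr// mulrC.
  have h1' : 0 <= h / T by rewrite divr_ge0// ltW.
  have tE : t = t' + h by rewrite addrC subrK.
  have -> : g t - g t' = (weight (t / T) - weight (t' / T))%:C *: f (t *: rho + theta)
      + (weight (t' / T))%:C *: (f (t *: rho + theta) - f (t' *: rho + theta)).
    by rewrite rmorphB/= scalerBl scalerBr addrA subrK.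
  rewrite (le_trans (ler_bnormD _ _))// /eps /L mulrDl !bnormZr; apply: lerD.
    have wl : `|weight (t / T) - weight (t' / T)| <= Z * (162 * (h / T)).
      by have := weight_lipschitz (t' / T) h1'; rewrite -mulrDl -tE.
    apply: (le_trans (ler_pM (normr_ge0 _) (bnorm_ge0 _) wl (fb _))).
    have -> : Z * (162 * (h / T)) * A%:R = Z * 162 * A%:R * (h / T) by ring.
    by rewrite ler_wpM2l// !mulr_ge0.
  rewrite -[leRHS]mulrA ler_pM ?bnorm_ge0//; first by rewrite ger0_norm ?weight_ge0// weight_le.
  have -> : t *: rho + theta = t' *: rho + theta + h *: rho.
    by rewrite tE scalerDl addrAC.
  apply: (@le_trans _ _ ((d%:R + 2) * A%:R ^+ 2 * (h * r))).
    apply: torus_lipschitz => // [|j]; first by rewrite mulr_ge0.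
    by rewrite mxE normrM ger0_norm// ler_wpM2l.
  rewrite -[leRHS]mulrA ler_wpM2l ?mulr_ge0 ?addr_ge0 ?exprn_ge0// mulrAC ler_wpM2r//.
have lgrid n (t : R) : `[0%R, T]%classic t -> bnorm (g t - phi n (l n t)) <= eps n.
  rewrite /= in_itv/= => /andP[t0]; rewrite le_eqVlt => /orP[/eqP tT|]; last exact: near_grid.
  have l0 : l n t = ord0.
    apply/cellP; exists 1; rewrite tT divff ?gt_eqF// mul0r addr0 lexx ltrDl.
    by rewrite divr_gt0// ltr0n.
  (* both values vanish, the weight being zero at the end points *)
  rewrite l0 /phi mul0r mulr0 /g mul0r tT divff ?gt_eqF// !weight_eq0 ?ltxx ?andbF//.
  rewrite !scale0r subrr bnorm0 /eps mulr_ge0// /L addr_ge0 ?mulr_ge0 ?addr_ge0 ?exprn_ge0//.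
  exact: ltW.
have muT : (lebesgue_measure (`[0%R, T]%classic : set R) < +oo)%E.
  by rewrite lebesgue_measure_itv/= lte_fin T0 ltry.
have ml n i : measurable (l n @^-1` [set i]) by exact: measurable_cell.
have eps0 : eps @ \oo --> (0 : R).
  by rewrite -(mulr0 L); apply: cvgMr; exact: cvg_harmonic.
have RS := cvg_riemann_bochner (mu := lebesgue_measure) (measurable_itv `[0%R, T])
  muT ml lgrid eps0.
apply: cvg_trans (cvgZl_tmp (k := (T^-1)%:C : (R[i] : numFieldType)) RS).
rewrite (_ : (fun n => orbit_mean n _ f theta) = (T^-1)%:C \*: (fun n =>
  \sum_i (fine (lebesgue_measure (`[0, T] `&` l n @^-1` [set i])))%:C *: phi n i)) //.
apply/funext => n /=.
rewrite /orbit_mean !scaler_sumr; apply: eq_bigr => i _; rewrite /phi /g !scalerA.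
rewrite (_ : fine _ = T / n.+1%:R); last by rewrite lebesgue_measure_cell.
have -> : T * (i%:R / n.+1%:R) / T = i%:R / n.+1%:R by rewrite mulrAC divff ?mul1r// gt_eqF.
have -> : theta + (i%:R * (T / n.+1%:R)) *: rho = (T * (i%:R / n.+1%:R)) *: rho + theta.
  by rewrite addrC mulrCA.
rewrite -!rmorphM/=; congr ((_ * _)%:C *: f _).
by rewrite mulrA mulVf ?mul1r// gt_eqF.
Qed.

Lemma dot_le (k : 'rV[int]_d) rho K : (forall j, `|k 0 j| <= K%:Z) ->
  `|dot k rho| <= K%:R * \sum_j `|rho 0 j|.
Proof.
move=> kK; rewrite mulr_sumr (le_trans (ler_norm_sum _ _ _))//; apply: ler_sum => j _.
by rewrite normrM ler_wpM2r// -intr_norm pmulrn ler_int.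
Qed.

(** Slowing the translation by [N] divides the small divisors by [N], and no
    nonzero integer interferes once the slowed frequencies are at most [1/2]. *)
Lemma slowed_dioph rho K (T delta N : R) : 0 < T -> 0 < N ->
  2 * (T * delta) <= N -> 2 * (T * (K%:R * \sum_j `|rho 0 j|)) <= N ->
  (forall k : 'rV[int]_d, k != 0 -> (forall j, `|k 0 j| <= K%:Z) -> delta <= `|dot k rho|) ->
  forall k : 'rV[int]_d, k != 0 -> (forall j, `|k 0 j| <= K%:Z) ->
    forall m : int, T * delta / N <= `|dot k ((T / N) *: rho) - m%:~R|.
Proof.
move=> T0 N0 dN rN dioph k k0 kK m; have TN : 0 < T / N by rewrite divr_gt0.
rewrite dotZr; have [->|m0] := eqVneq m 0.
  by rewrite subr0 normrM gtr0_norm// mulrAC ler_wpM2l ?(ltW TN)// dioph.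
have h1 : `|T / N * dot k rho| <= 2^-1.
  rewrite normrM gtr0_norm//.
  apply: (le_trans (ler_wpM2l (ltW TN) (dot_le rho kK))).
  by rewrite mulrAC ler_pdivrMr// ler_pdivlMl.
have h2 : T * delta / N <= 2^-1 by rewrite ler_pdivrMr// ler_pdivlMl.
have h3 : 1 <= `|m%:~R| :> R by rewrite -intr_norm ler1z -gtz0_ge1 normr_gt0.
have := lerB_dist (m%:~R : R) (T / N * dot k rho); rewrite distrC => h4.
by rewrite (le_trans h2)//; apply: le_trans h4; lra.
Qed.

Lemma near_mean_weight : \forall n \near \oo, 2^-1 <= (mean_weight n : R) <= 2.
Proof.
have h : 0 < 2^-1 :> R by rewrite invr_gt0.
have := @cvg_mean_weight R => /cvgrPdist_lt /(_ _ h); apply: filterS => n.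
by rewrite ltr_norml => /andP[h1 h2]; apply/andP; split; lra.
Qed.

Lemma cvg_mean_weight_scale (v : B) : (fun n => (mean_weight n)%:C *: v) @ \oo --> v.
Proof.
apply/cvg_bnormP => e e0; have b0 : 0 < bnorm v + 1 by rewrite ltr_wpDl// bnorm_ge0.
have := @cvg_mean_weight R => /cvgrPdist_lt /(_ _ (divr_gt0 e0 b0)); apply: filterS => n h.
rewrite -[X in X - _]scale1r -scalerBl -[1]/(1%:C) -rmorphB bnormZr.
rewrite (@le_lt_trans _ _ (`|1 - mean_weight n| * (bnorm v + 1)))//.
  by rewrite ler_wpM2l// lerDl.
by rewrite -ltr_pdivlMr.
Qed.

Lemma estimate_le (C Q W E1 E2 Y : R) : 0 <= C -> 0 <= Q -> 0 <= E1 -> 0 <= E2 -> W <= 2 ->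
  Q * (E1 + E2) <= Y -> C * Q * (W * E1 + E2) <= 2 * C * Y.
Proof.
move=> C0 Q0 E10 E20 W2 QY.
have h : W * E1 + E2 <= 2 * (E1 + E2) by nra.
have CQ : 0 <= C * Q by rewrite mulr_ge0.
apply: (le_trans (ler_wpM2l CQ h)).
have -> : C * Q * (2 * (E1 + E2)) = 2 * C * (Q * (E1 + E2)) by ring.
by rewrite ler_wpM2l// mulr_ge0.
Qed.

End averages.

Theorem corollary3p5 (R : realType) :
  exists2 beta : R, 0 < beta &
  forall (d : nat) (tau alpha : R) (rho : 'rV[R]_d)
      (B : completeNormedModType R[i]) (f : 'rV[R]_d -> B),
    (0 < d)%N -> d%:R - 1 < tau -> 0 < alpha ->
    torus_periodic f -> torus_analytic f ->
    let xi := beta * (1 + tau * beta)^-1 in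
    0 < xi /\
    exists c C5 : R,
      [/\ 0 < c,
          0 < C5,
          diophantine_discrete alpha tau rho ->
            \forall N \near \oo, forall theta,
              bnorm (weighted_birkhoff_discrete N rho f theta
                     - torus_integral f)
                <= C5 * expR (- c * N%:R `^ xi)
        & diophantine_continuous alpha tau rho ->
            \forall T \near +oo, forall theta,
              bnorm (weighted_birkhoff_continuous T rho f theta
                     - torus_integral f)
                <= C5 * expR (- c * T `^ xi)].
Proof.
(* the exponent of [weighted_sum_le] *)
exists 4^-1; first by rewrite invr_gt0.
move=> d tau alpha rho B f d0 dtau alpha0 fper fan xi.
have tau0 : 0 < tau by rewrite (le_lt_trans _ dtau)// subr_ge0 ler1n.
have xi0 : 0 < xi by rewrite mulr_gt0 ?invr_gt0// addr_gt0// mulr_gt0 ?invr_gt0.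
split=> //.
have [A A0 fA] := torus_analytic_uniform fper fan.
have [C C0 [c c0 main]] := @orbit_mean_approx R d B A A0 d0.
have [C' C'0 [c' c'0 rate]] := truncation_rate d0 tau0 alpha0 c0.
exists c', (4 * C * C'); split => // [|dioph|dioph].
- by rewrite !mulr_gt0.
- have divisor K (k : 'rV[int]_d) : k != 0 -> (forall j, `|k 0 j| <= K%:Z) -> forall m : int,
      alpha / (d%:R * K%:R) `^ tau <= `|dot k rho - m%:~R|.
    by move=> k0 kK m; apply: le_trans (dioph k k0 m); exact: small_divisor_box.
  have [M _ HM] := @near_mean_weight R.
  near=> N => theta.
  have MN : (M < N)%N by near: N; exact: nbhs_infty_gt.
  have [n NE] : exists n, N = n.+1 by exists N.-1; rewrite prednK// (leq_ltn_trans _ MN).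
  have /HM /= /andP[W1 W2] : (M <= n)%N by rewrite -ltnS -NE.
  rewrite NE.
  have W0 : 0 < mean_weight n :> R by rewrite (lt_le_trans _ W1)// invr_gt0.
  have [K K0 hK] := rate n.+1%:R ltac:(by rewrite ler1n).
  set delta := alpha / _ in hK.
  have delta0 : 0 < delta by rewrite divr_gt0// powR_gt0// mulr_gt0// ltr0n.
  have := main K f n rho theta delta fA delta0 (divisor K).
  set E1 := expR (- c * K%:R) in hK *; set E2 := expR (- c * _) in hK *.
  have E10 : 0 <= E1 by exact: expR_ge0.
  have E20 : 0 <= E2 by exact: expR_ge0.
  rewrite weighted_birkhoff_discreteE// => est.
  have -> : ((mean_weight n)^-1)%:C *: orbit_mean n rho f theta - torus_integral f =
     ((mean_weight n)^-1)%:C *: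
       (orbit_mean n rho f theta - (mean_weight n)%:C *: torus_integral f).
    have WV : ((mean_weight n)^-1)%:C * (mean_weight n)%:C = 1 :> R[i].
      by rewrite -(rmorphM (real_complex R))/= mulVf ?gt_eqF.
    by rewrite scalerBr [_ *: (_ *: torus_integral f)]scalerA WV scale1r.
  rewrite bnormZr gtr0_norm ?invr_gt0// mulrC ler_pdivrMr//.
  have := estimate_le (ltW C0) (exprn_ge0 d (ler0n R _)) E10 E20 W2 hK.
  move=> /(le_trans est) /le_trans; apply.
  set X := expR _; have CX : 0 <= C * (C' * X) by rewrite !mulr_ge0 ?expR_ge0 ?ltW.
  nra.
- have divisor K (k : 'rV[int]_d) : k != 0 -> (forall j, `|k 0 j| <= K%:Z) ->
      alpha / (d%:R * K%:R) `^ tau <= `|dot k rho|.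
    by move=> k0 kK; apply: le_trans (dioph k k0); exact: small_divisor_box.
  near=> T => theta.
  have T1 : 1 <= T by near: T; exact: nbhs_pinfty_ge.
  have T0 : 0 < T by rewrite (lt_le_trans ltr01).
  have [K K0 hK] := rate T T1.
  set delta := alpha / _ in hK.
  have delta0 : 0 < delta by rewrite divr_gt0// powR_gt0// mulr_gt0// ltr0n.
  have cW : (fun n => (mean_weight n)%:C *: torus_integral f) @ \oo --> torus_integral f.
    exact: cvg_mean_weight_scale.
  have lim := cvgB (cvg_orbit_mean_continuous (rho := rho) (theta := theta) A0 d0 fA T0) cW.
  apply: (cvg_bnorm_le (lim _)).
  near=> n.
  rewrite [X in bnorm X](_ : _ = orbit_mean n ((T / n.+1%:R) *: rho) f theta
     - (mean_weight n)%:C *: torus_integral f)//.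
  have N0 : 0 < n.+1%:R :> R by rewrite ltr0n.
  have nN : n%:R <= n.+1%:R :> R by rewrite ler_nat.
  have W2 : mean_weight n <= 2 :> R.
    by have /andP[] : 2^-1 <= (mean_weight n : R) <= 2 by near: n; exact: near_mean_weight.
  have N1 : 2 * (T * delta) <= n.+1%:R.
    by apply: le_trans nN; near: n; exact: nbhs_infty_ger.
  have N2 : 2 * (T * (K%:R * \sum_j `|rho 0 j|)) <= n.+1%:R.
    by apply: le_trans nN; near: n; exact: nbhs_infty_ger.
  have delta'0 : 0 < T * delta / n.+1%:R by rewrite divr_gt0// mulr_gt0.
  have := main K f n _ theta _ fA delta'0 (slowed_dioph T0 N0 N1 N2 (divisor K)).
  rewrite mulrCA mulfV ?gt_eqF// mulr1 => /le_trans; apply.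
  apply: (le_trans (estimate_le (ltW C0) (exprn_ge0 d (ler0n R _))
    (expR_ge0 _) (expR_ge0 _) W2 hK)).
  set X := expR _; have CX : 0 <= C * (C' * X) by rewrite !mulr_ge0 ?expR_ge0 ?ltW.
  nra.
Unshelve. all: by end_near. Qed.
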